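(* Let $R$ be a commutative ring. (1) Let $M\in D(R)$ be a complex of $R$-modules and $n$ an integer such that $H^i(M)=0$ for all $i<n$ (for example, $M$ is a module). Then $$\operatorname{\widetilde{Ass}}_RH^n(M)\subseteq\operatorname{supp}M.$$ In particular, for such complexes (those with $H^i(M)=0$ for $i\ll0$), $M=0$ if and only if $\operatorname{supp}M=\emptyset$. (2) For any complex $M\in D(R)$, $$\min\operatorname{\widetilde{Ass}}_R\bigoplus_{i\in\mathbb Z}H^i(M)\subseteq\operatorname{supp}M.$$ (3) If the prime ideals of $R$ satisfy the descending chain condition, then $D(R)$ is supportive, i.e. for all $M\in D(R)$, $\operatorname{supp}M=\emptyset$ if and only if $M=0$.
   Context: $R$ is an arbitrary commutative ring (not assumed Noetherian), $D(R)$ its unbounded derived category. For a finite sequence $\underline{x}=x_1,\dots,x_n\in R$, let $K_\infty(\underline{x})=(R\to R_{x_1})\otimes_R\cdots\otimes_R(R\to R_{x_n})$, each factor being the localisation map viewed as a complex in degrees $0,1$ (for the empty sequence it is $R$). A prime $\mathfrak p\in\operatorname{Spec}R$ lies in $\operatorname{supp}M$ if for every finite sequence $\underline{x}$ of elements of $\mathfrak p$ there is some $i\in\mathbb Z$ with $H^i(K_\infty(\underline{x})\otimes_RM_{\mathfrak p})\neq0$. For an $R$-module $N$, a prime $\mathfrak p$ is weakly associated to $N$ if there is $m\in N$ such that $\mathfrak p$ is minimal among the primes containing $\operatorname{ann}(m)$. $\operatorname{\widetilde{Ass}}_RN$ is the set of weakly associated primes of $N$, and $\min\operatorname{\widetilde{Ass}}_RN$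 is the set of its inclusion-minimal elements. ''$M=0$'' means $M$ is zero in $D(R)$, i.e. acyclic. *)

(* Defs.v *)
From HB Require Import structures.
From mathcomp Require Import all_boot all_order all_algebra.
From mathcomp Require Import finmap ring boolp classical_sets functions cardinality fsbigop.

Set Implicit Arguments.
Unset Strict Implicit.
Unset Printing Implicit Defensive.

Import Order.TTheory GRing.Theory Num.Theory.
Local Open Scope classical_set_scope.
Local Open Scope ring_scope.
Local Open Scope quotient_scope.

Section Modules.
Variable R : comPzRingType.

Definition mklin (U V : lmodType R) (f : U -> V) (hf : linear f) :
  {linear U -> V} := HB.pack f (GRing.isLinear.Build R U V *:%R f hf).

Definition is_zero (N : lmodType R) : Prop := forall x : N, x = 0.

Section Quotient.
Variables (V : lmodType R) (W : submodClosed V).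

Fact submod_zmod_closed : zmod_closed (W : {pred V}).
Proof. by split=> [|u v uW vW]; rewrite ?rpred0 // rpredD // -scaleN1r rpredZ. Qed.

Definition zmod_of_submod : zmodClosed V :=
  HB.pack (W : {pred V})
    (GRing.isZmodClosed.Build V (W : {pred V}) submod_zmod_closed).

Definition lquot : Type := Quotient.quot zmod_of_submod.
HB.instance Definition _ := GRing.Zmodule.on lquot.
HB.instance Definition _ := EqQuotient.on lquot.

Definition lquot_pi (v : V) : lquot := \pi_lquot v.
Definition lquot_scale (a : R) (q : lquot) : lquot :=
  lquot_pi (a *: repr q).

Lemma lquot_piP u v : lquot_pi u = lquot_pi v <-> u - v \in W.
Proof.
rewrite -[_ \in W]/(u - v \in zmod_of_submod) Quotient.idealrBE.
by split=> /eqP.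
Qed.

Lemma lquot_reprK (q : lquot) : lquot_pi (repr q) = q.
Proof. exact: reprK. Qed.

Lemma lquot_piD u v : lquot_pi (u + v) = lquot_pi u + lquot_pi v.
Proof. exact: (@raddfD _ _ \pi_lquot). Qed.

Lemma lquot_scaleE a v : lquot_scale a (lquot_pi v) = lquot_pi (a *: v).
Proof.
apply/lquot_piP; rewrite -scalerBr; apply/rpredZ/lquot_piP.
exact: lquot_reprK.
Qed.

Fact lquot_scaleA a b q :
  lquot_scale a (lquot_scale b q) = lquot_scale (a * b) q.
Proof. by rewrite -[q]lquot_reprK !lquot_scaleE scalerA. Qed.

Fact lquot_scale1 : left_id 1 lquot_scale.
Proof. by move=> q; rewrite -[q]lquot_reprK !lquot_scaleE scale1r. Qed.

Fact lquot_scaleDr : right_distributive lquot_scale +%R.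
Proof.
move=> a q r; rewrite -[q]lquot_reprK -[r]lquot_reprK.
by rewrite -lquot_piD !lquot_scaleE scalerDr lquot_piD.
Qed.

Fact lquot_scaleDl q : {morph lquot_scale^~ q : a b / a + b}.
Proof.
move=> a b; rewrite -[q]lquot_reprK.
by rewrite !lquot_scaleE scalerDl lquot_piD.
Qed.

HB.instance Definition _ := GRing.Zmodule_isLmodule.Build R lquot
  lquot_scaleA lquot_scale1 lquot_scaleDr lquot_scaleDl.

Fact lquot_pi_is_linear : linear lquot_pi.
Proof. by move=> a u v; rewrite lquot_piD -lquot_scaleE. Qed.
HB.instance Definition _ :=
  GRing.isLinear.Build R V lquot *:%R lquot_pi lquot_pi_is_linear.

Section Lift.
Variables (U : lmodType R) (f : {linear V -> U}).
Hypothesis fW : forall w, w \in W -> f w = 0.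

Fact lquot_lift_pi v : f (repr (lquot_pi v)) = f v.
Proof.
apply/eqP; rewrite -subr_eq0 -raddfB; apply/eqP/fW/lquot_piP.
exact: lquot_reprK.
Qed.

Fact lquot_lift_is_linear : linear (fun q : lquot => f (repr q)).
Proof.
move=> a q r; rewrite -[q]lquot_reprK -[r]lquot_reprK -linearP.
by rewrite !lquot_lift_pi linearP.
Qed.

Definition lquot_lift : {linear lquot -> U} := mklin lquot_lift_is_linear.

Lemma lquot_liftE v : lquot_lift (lquot_pi v) = f v.
Proof. exact: lquot_lift_pi. Qed.
End Lift.

End Quotient.

Section Span.
Variables (V : lmodType R) (G : set V).

Definition span : {pred V} := fun v =>
  `[< forall W : submodClosed V, (forall g, G g -> g \in W) -> v \in W >].

Fact span_submod : submod_closed span.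
Proof.
split=> [|a u v /asboolP su /asboolP sv]; apply/asboolP => W GW.
  exact: rpred0.
by apply: rpredD; [apply: rpredZ; apply: su | apply: sv].
Qed.
HB.instance Definition _ := GRing.isSubmodClosed.Build R V span span_submod.

Lemma span_gen g : G g -> g \in span.
Proof. by move=> Gg; apply/asboolP => W; apply. Qed.

Lemma span_lin0 (U : lmodType R) (f : {linear V -> U}) :
  (forall g, G g -> f g = 0) -> forall v, v \in span -> f v = 0.
Proof.
move=> fG v /asboolP sv.
pose K : {pred V} := fun v => f v == 0.
have Ksub : submod_closed K.
  split=> [|a x y /eqP fx /eqP fy]; apply/eqP; first exact: raddf0.
  by rewrite linearP fx fy scaler0 addr0.
pose KW : submodClosed V := HB.pack K (GRing.isSubmodClosed.Build R V K Ksub).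
by have /eqP := sv KW (fun g Gg => introT eqP (fG g Gg)).
Qed.
End Span.

Section DirectSum.
Variables (I : choiceType) (V : I -> lmodType R).

Definition dprod : Type := forall i, V i.
HB.instance Definition _ := gen_eqMixin dprod.
HB.instance Definition _ := gen_choiceMixin dprod.

Implicit Types f g h : dprod.
Let add f g : dprod := fun i => f i + g i.
Let opp f : dprod := fun i => - f i.
Let zero : dprod := fun i => 0.
Let scale (a : R) f : dprod := fun i => a *: f i.

Fact dprod_addA : associative add.
Proof. by move=> f g h; apply: functional_extensionality_dep => i; exact: addrA. Qed.
Fact dprod_addC : commutative add.
Proof. by move=> f g; apply: functional_extensionality_dep => i; exact: addrC. Qed.
Fact dprod_add0 : left_id zero add.
Proof. by move=> f; apply: functional_extensionality_dep => i; exact: add0r. Qed.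
Fact dprod_addN : left_inverse zero opp add.
Proof. by move=> f; apply: functional_extensionality_dep => i; exact: addNr. Qed.
HB.instance Definition _ :=
  GRing.isZmodule.Build dprod dprod_addA dprod_addC dprod_add0 dprod_addN.

Fact dprod_scaleA a b f : scale a (scale b f) = scale (a * b) f.
Proof. by apply: functional_extensionality_dep => i; exact: scalerA. Qed.
Fact dprod_scale1 : left_id 1 scale.
Proof. by move=> f; apply: functional_extensionality_dep => i; exact: scale1r. Qed.
Fact dprod_scaleDr : right_distributive scale +%R.
Proof. by move=> a f g; apply: functional_extensionality_dep => i; exact: scalerDr. Qed.
Fact dprod_scaleDl f : {morph scale^~ f : a b / a + b}.
Proof. by move=> a b; apply: functional_extensionality_dep => i; exact: scalerDl. Qed.
HB.instance Definition _ := GRing.Zmodule_isLmodule.Build R dprod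
  dprod_scaleA dprod_scale1 dprod_scaleDr dprod_scaleDl.

Definition fsupp : {pred dprod} := fun f => `[< finite_set [set i | f i != 0] >].

Fact fsupp_submod : submod_closed fsupp.
Proof.
split=> [|a f g /asboolP Ff /asboolP Fg]; apply/asboolP.
  by rewrite (_ : [set _ | _] = set0) // -subset0 => i /=; rewrite eqxx.
apply: (@sub_finite_set _ _ ([set i | f i != 0] `|` [set i | g i != 0])).
  move=> i; rewrite /mkset -[X in X != 0]/(a *: f i + g i).
  have [->|fi0 _] := eqVneq (f i) 0; last by left.
  by rewrite scaler0 add0r; right.
by rewrite finite_setU.
Qed.
HB.instance Definition _ := GRing.isSubmodClosed.Build R dprod fsupp fsupp_submod.

Record dsum : Type := DSum { dsum_val : dprod; dsum_valP : dsum_val \in fsupp }.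
HB.instance Definition _ := [isSub for dsum_val].
HB.instance Definition _ := [Choice of dsum by <:].
HB.instance Definition _ := [SubChoice_isSubLmodule of dsum by <:].

Definition coord (v : dsum) (i : I) : V i := val v i.

Lemma dsumP (u v : dsum) : (forall i, coord u i = coord v i) -> u = v.
Proof. by move=> uv; apply/val_inj/functional_extensionality_dep. Qed.

Lemma coordP i a u v : coord (a *: u + v) i = a *: coord u i + coord v i.
Proof. by []. Qed.

Fact dsum_in_fsupp i (x : V i) :
  (dfwith (fun j => 0 : V j) x : dprod) \in fsupp.
Proof.
apply/asboolP; apply: (@sub_finite_set _ _ [set i]) => // j /=.
move=> nz; apply/eqP; apply: contraNT nz => ji.
by rewrite dfwith_out // eq_sym.
Qed.

Fact dsum_in_is_linear i : linear (fun x : V i => DSum (dsum_in_fsupp x)).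
Proof.
move=> a x y; apply: dsumP => j; rewrite coordP /coord /=.
have [ij|ij] := boolP (i == j); last by rewrite !dfwith_out // scaler0 addr0.
by case: _ / (eqP ij); rewrite !dfwith_in.
Qed.
Definition dsum_in i : {linear V i -> dsum} := mklin (@dsum_in_is_linear i).

Section Lift.
Variables (U : lmodType R) (f : forall i, {linear V i -> U}).

Let lift (v : dsum) : U := \sum_(i \in [set i | coord v i != 0]) f i (coord v i).

Let liftE (A : set I) (v : dsum) : finite_set A ->
  (forall i, coord v i != 0 -> A i) -> lift v = \sum_(i \in A) f i (coord v i).
Proof.
move=> finA sub; apply: fsbig_widen => [|i [_ /=]]; first exact: sub.
by move/negP; rewrite negbK => /eqP ->; rewrite raddf0.
Qed.

Let fin_coord (v : dsum) : finite_set [set i | coord v i != 0].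
Proof. by have /asboolP := dsum_valP v. Qed.

Fact dsum_lift_is_linear : linear lift.
Proof.
move=> a u v; set A := [set i | coord u i != 0] `|` [set i | coord v i != 0].
have finA : finite_set A by rewrite finite_setU; split; exact: fin_coord.
rewrite !(@liftE A) //.
- rewrite -[in RHS]/(GRing.scale a _) !fsbig_finite //= scaler_sumr -big_split.
  by apply: eq_bigr => i _; rewrite coordP linearP.
- by move=> i vi; right.
- by move=> i ui; left.
- move=> i; rewrite coordP; have [ui | ui _] := eqVneq (coord u i) 0; last by left.
  by rewrite ui scaler0 add0r; right.
Qed.
Definition dsum_lift : {linear dsum -> U} := mklin dsum_lift_is_linear.

Lemma dsum_lift_in i x : dsum_lift (dsum_in i x) = f i x.
Proof.
rewrite -[LHS]/(lift _) (@liftE [set i]) ?fsbig_set1 /coord /= ?dfwith_in //.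
move=> j nz; apply/eqP; apply: contraNT nz => ij.
by rewrite /coord /= dfwith_out // eq_sym.
Qed.
End Lift.

Lemma dsum_sum (v : dsum) :
  v = \sum_(i \in [set i | coord v i != 0]) dsum_in i (coord v i).
Proof.
have fin_v : finite_set [set i | coord v i != 0] by have /asboolP := dsum_valP v.
apply: dsumP => i; rewrite fsbig_finite //=.
pose ci := mklin (fun a u w => coordP i a u w).
rewrite -[RHS]/(ci _) linear_sum /=.
case: (boolP (i \in fset_set [set i | coord v i != 0])) => vi.
  rewrite (bigD1_seq i) ?fset_uniq //= big1 ?addr0.
    by rewrite /coord /= dfwith_in.
  by move=> j ji; rewrite /coord /= dfwith_out.
rewrite big_seq big1 => [|j jv].
  by move: vi; rewrite in_fset_set // notin_setE /= => /negP; rewrite negbK => /eqP.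
by rewrite /coord /= dfwith_out //; apply: contraNneq vi => <-.
Qed.

Lemma dsum_lin_ext (U : lmodType R) (f g : {linear dsum -> U}) :
  (forall i x, f (dsum_in i x) = g (dsum_in i x)) -> f =1 g.
Proof.
move=> fg v; have fin_v : finite_set [set i | coord v i != 0].
  by have /asboolP := dsum_valP v.
rewrite [v]dsum_sum fsbig_finite //= !linear_sum.
by apply: eq_bigr => i _; exact: fg.
Qed.
End DirectSum.

Definition freemod (X : choiceType) : lmodType R := dsum (fun _ : X => R^o).
Definition gen (X : choiceType) (x : X) : freemod X :=
  @dsum_in X (fun _ => R^o) x 1.

Fact scale_gen_is_linear (U : lmodType R) (u : U) : linear (fun r : R^o => r *: u).
Proof. by move=> a r s; rewrite scalerDl scalerA. Qed.

Lemma freemod_lin_ext (X : choiceType) (U : lmodType R)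
    (f g : {linear freemod X -> U}) :
  (forall x, f (gen x) = g (gen x)) -> f =1 g.
Proof.
move=> fg; apply: dsum_lin_ext => x r.
suff -> : @dsum_in X (fun _ => R^o) x r = r *: gen x by rewrite !linearZ fg.
by rewrite -linearZ /= -[r in LHS]mulr1.
Qed.

Section Tensor.
Variables A B : lmodType R.

Variant tens_rel : set (freemod (A * B)%type) :=
| TensAddl a a' b : tens_rel (gen (a + a', b) - (gen (a, b) + gen (a', b)))
| TensAddr a b b' : tens_rel (gen (a, b + b') - (gen (a, b) + gen (a, b')))
| TensScalel r a b : tens_rel (gen (r *: a, b) - r *: gen (a, b))
| TensScaler r a b : tens_rel (gen (a, r *: b) - r *: gen (a, b)).

Definition tens : lmodType R := lquot (span tens_rel).
Definition tprod (a : A) (b : B) : tens := lquot_pi _ (gen (a, b)).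

Lemma tprodDl a a' b : tprod (a + a') b = tprod a b + tprod a' b.
Proof. by rewrite -lquot_piD; apply/lquot_piP/span_gen/TensAddl. Qed.
Lemma tprodDr a b b' : tprod a (b + b') = tprod a b + tprod a b'.
Proof. by rewrite -lquot_piD; apply/lquot_piP/span_gen/TensAddr. Qed.
Lemma tprodZl r a b : tprod (r *: a) b = r *: tprod a b.
Proof. by rewrite -linearZ; apply/lquot_piP/span_gen/TensScalel. Qed.
Lemma tprodZr r a b : tprod a (r *: b) = r *: tprod a b.
Proof. by rewrite -linearZ; apply/lquot_piP/span_gen/TensScaler. Qed.

Lemma tens_lin_ext (U : lmodType R) (f g : {linear tens -> U}) :
  (forall a b, f (tprod a b) = g (tprod a b)) -> f =1 g.
Proof.
move=> fg q; rewrite -[q]lquot_reprK; move: (repr q) => v.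
apply: (freemod_lin_ext (f := f \o @lquot_pi _ (span tens_rel))
                        (g := g \o @lquot_pi _ (span tens_rel))) => -[a b].
exact: fg.
Qed.

Lemma tprod0l b : tprod 0 b = 0.
Proof. by rewrite -(scale0r 0) tprodZl scale0r. Qed.
Lemma tprod0r a : tprod a 0 = 0.
Proof. by rewrite -(scale0r 0) tprodZr scale0r. Qed.

Section Lift.
Variables (U : lmodType R) (f : A -> B -> U).
Hypotheses (fl : forall b, linear (f^~ b)) (fr : forall a, linear (f a)).

Let flift : {linear freemod (A * B)%type -> U} :=
  dsum_lift (fun ab => mklin (scale_gen_is_linear (f ab.1 ab.2))).

Let flift_gen a b : flift (gen (a, b)) = f a b.
Proof. by rewrite dsum_lift_in /= scale1r. Qed.

Fact tens_lift_rel w : w \in span tens_rel -> flift w = 0.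
Proof.
pose Fl b := mklin (fl b); pose Fr a := mklin (fr a).
apply: span_lin0 => _ [a a' b|a b b'|r a b|r a b];
  apply/eqP; rewrite linearB subr_eq0 ?linearD ?linearZ_LR !flift_gen; apply/eqP.
- exact: (raddfD (Fl b)).
- exact: (raddfD (Fr a)).
- exact: (linearZ_LR (Fl b)).
- exact: (linearZ_LR (Fr a)).
Qed.

Definition tens_lift : {linear tens -> U} := lquot_lift tens_lift_rel.

Lemma tens_liftE a b : tens_lift (tprod a b) = f a b.
Proof. by rewrite lquot_liftE flift_gen. Qed.
End Lift.

End Tensor.

Section TensorMap.
Variables (A B A' B' : lmodType R).
Variables (f : {linear A -> A'}) (g : {linear B -> B'}).

Fact tens_map_linl b : linear (fun a => tprod (f a) (g b)).
Proof. by move=> r a a'; rewrite linearP tprodDl tprodZl. Qed.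
Fact tens_map_linr a : linear (fun b => tprod (f a) (g b)).
Proof. by move=> r b b'; rewrite linearP tprodDr tprodZr. Qed.

Definition tens_map : {linear tens A B -> tens A' B'} :=
  tens_lift tens_map_linl tens_map_linr.

Lemma tens_mapE a b : tens_map (tprod a b) = tprod (f a) (g b).
Proof. exact: tens_liftE. Qed.
End TensorMap.

(* The localisation S^-1 V, regarded as an R-module: fractions v / s, with
   v / s = w / t iff u (t v - s w) = 0 for some u in S. *)
Section Localization.
Variables (S : mulrClosed R) (V : lmodType R).

Definition denom : Type := {s : R | s \in S}.
HB.instance Definition _ := Choice.on denom.

Definition frac_equiv (x y : V * denom) : bool :=
  `[< exists2 u : R, u \in S &
        u *: (sval y.2 *: x.1 - sval x.2 *: y.1) = 0 >].

Fact scale_subst (a b c k : R) (v w : V) :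
  b *: v = c *: w -> a = k * b -> a *: v = (k * c) *: w.
Proof. by move=> e ->; rewrite -scalerA e scalerA. Qed.

Fact frac_equiv_is_equiv : equiv_class_of frac_equiv.
Proof.
split=> [[v s]|[v s] [w t]|[w t] [v s] [z r]].
- by apply/asboolP; exists 1; rewrite ?rpred1 // subrr scaler0.
- by apply/asboolP/asboolP => -[u uS /= e]; exists u => //=;
    rewrite -opprB scalerN e oppr0.
move=> /asboolP[u uS /= e] /asboolP[u' u'S /= e']; apply/asboolP => /=.
exists (u * u' * sval t); first by rewrite !rpredM // (valP t).
move: e e'; rewrite !scalerBr !scalerA => /subr0_eq e /subr0_eq e'.
rewrite (scale_subst (k := u' * sval r) e); last by ring.
rewrite (scale_subst (k := u * sval s) (esym e')); last by ring.
by apply/eqP; rewrite subr_eq0; apply/eqP; congr (_ *: _); ring.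
Qed.

Canonical frac_equivRel := EquivRelPack frac_equiv_is_equiv.
Canonical frac_encModRel := defaultEncModRel frac_equiv.

Definition loc : Type := {eq_quot frac_equiv}.
HB.instance Definition _ : EqQuotient _ frac_equiv loc := EqQuotient.on loc.
HB.instance Definition _ := Choice.on loc.

Definition frac (v : V) (s : denom) : loc := \pi_loc (v, s).

Lemma fracP v s w t : frac v s = frac w t <->
  exists2 u : R, u \in S & u *: (sval t *: v - sval s *: w) = 0.
Proof.
split=> [/eqmodP/asboolP //|h]; apply/eqmodP; exact/asboolP.
Qed.

Lemma frac_ind (P : loc -> Prop) : (forall v s, P (frac v s)) -> forall x, P x.
Proof. by move=> Pf x; rewrite -[x]reprK; case: (repr x) => v s; exact: Pf. Qed.

Lemma frac_eq v s w t : sval t *: v = sval s *: w -> frac v s = frac w t.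
Proof. by move=> e; apply/fracP; exists 1; rewrite ?rpred1 // e subrr scaler0. Qed.

Lemma frac_repr v s : exists x : V * denom,
  repr (frac v s) = x /\ frac x.1 x.2 = frac v s.
Proof.
exists (repr (frac v s)); split=> //.
by rewrite -[RHS]reprK; case: (repr (frac v s)).
Qed.

Definition denom1 : denom := exist _ 1 (rpred1 S).
Definition denomM (s t : denom) : denom :=
  exist _ (sval s * sval t) (rpredM (proj2_sig s) (proj2_sig t)).

Definition frac_add (x y : V * denom) : loc :=
  frac (sval y.2 *: x.1 + sval x.2 *: y.1) (denomM x.2 y.2).
Definition loc_add (x y : loc) : loc := frac_add (repr x) (repr y).
Definition loc_opp (x : loc) : loc := frac (- (repr x).1) (repr x).2.
Definition loc_scale (a : R) (x : loc) : loc := frac (a *: (repr x).1) (repr x).2.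

Lemma loc_addE v s w t : loc_add (frac v s) (frac w t) =
  frac (sval t *: v + sval s *: w) (denomM s t).
Proof.
rewrite /loc_add.
have [[v' s'] [-> /fracP[u uS /= e]]] := frac_repr v s.
have [[w' t'] [-> /fracP[u' u'S /= e']]] := frac_repr w t.
move: e e'; rewrite !scalerBr !scalerA => /subr0_eq e /subr0_eq e'.
apply/fracP; exists (u * u'); first by rewrite rpredM.
rewrite /= !(scalerBr, scalerDr) !scalerA.
rewrite (scale_subst (k := u' * sval t * sval t') e); last by ring.
rewrite (scale_subst (k := u * sval s * sval s') e'); last by ring.
by apply/eqP; rewrite subr_eq0; apply/eqP; congr (_ *: _ + _ *: _); ring.
Qed.

Lemma loc_scaleE a v s : loc_scale a (frac v s) = frac (a *: v) s.
Proof.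
rewrite /loc_scale.
have [[v' s'] [-> /fracP[u uS /= e]]] := frac_repr v s.
move: e; rewrite !scalerBr !scalerA => /subr0_eq e.
apply/fracP; exists u => //; rewrite /= !scalerBr !scalerA.
rewrite (scale_subst (k := a) e); last by ring.
by apply/eqP; rewrite subr_eq0; apply/eqP; congr (_ *: _); ring.
Qed.

Lemma loc_oppE v s : loc_opp (frac v s) = frac (- v) s.
Proof.
by rewrite /loc_opp -scaleN1r -[- v]scaleN1r; exact: loc_scaleE.
Qed.

Fact loc_addA : associative loc_add.
Proof.
elim/frac_ind=> v s; elim/frac_ind=> w t; elim/frac_ind=> z r.
rewrite !loc_addE; apply: frac_eq; rewrite /= !scalerDr !scalerA !addrA.
by congr (_ *: _ + _ *: _ + _ *: _); ring.
Qed.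
Fact loc_addC : commutative loc_add.
Proof.
elim/frac_ind=> v s; elim/frac_ind=> w t.
rewrite !loc_addE; apply: frac_eq; rewrite /= !scalerDr !scalerA addrC.
by congr (_ *: _ + _ *: _); ring.
Qed.
Fact loc_add0 : left_id (frac 0 denom1) loc_add.
Proof.
elim/frac_ind=> v s; rewrite loc_addE; apply: frac_eq.
by rewrite /= scaler0 add0r scale1r mul1r.
Qed.
Fact loc_addN : left_inverse (frac 0 denom1) loc_opp loc_add.
Proof.
elim/frac_ind=> v s; rewrite loc_oppE loc_addE; apply: frac_eq.
by rewrite /= scalerN addNr !scaler0.
Qed.
HB.instance Definition _ :=
  GRing.isZmodule.Build loc loc_addA loc_addC loc_add0 loc_addN.

Lemma fracD v s w t :
  frac v s + frac w t = frac (sval t *: v + sval s *: w) (denomM s t).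
Proof. exact: loc_addE. Qed.

Fact loc_scaleA a b x : loc_scale a (loc_scale b x) = loc_scale (a * b) x.
Proof. by elim/frac_ind: x => v s; rewrite !loc_scaleE scalerA. Qed.
Fact loc_scale1 : left_id 1 loc_scale.
Proof. by elim/frac_ind=> v s; rewrite loc_scaleE scale1r. Qed.
Fact loc_scaleDr : right_distributive loc_scale +%R.
Proof.
move=> a; elim/frac_ind=> v s; elim/frac_ind=> w t.
rewrite fracD !loc_scaleE fracD; apply: frac_eq.
by rewrite /= !scalerDr !scalerA; congr (_ *: _ + _ *: _); ring.
Qed.
Fact loc_scaleDl x : {morph loc_scale^~ x : a b / a + b}.
Proof.
move=> a b; elim/frac_ind: x => v s; rewrite !loc_scaleE fracD; apply: frac_eq.
by rewrite /= -!scalerDr -scalerDl !scalerA; congr (_ *: _); ring.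
Qed.
HB.instance Definition _ := GRing.Zmodule_isLmodule.Build R loc
  loc_scaleA loc_scale1 loc_scaleDr loc_scaleDl.

Lemma fracZ a v s : a *: frac v s = frac (a *: v) s.
Proof. exact: loc_scaleE. Qed.

Fact loc_in_is_linear : linear (fun v : V => frac v denom1).
Proof.
move=> a v w; rewrite fracZ fracD.
by apply: frac_eq; rewrite /= !scale1r mul1r scale1r.
Qed.
Definition loc_in : {linear V -> loc} := mklin loc_in_is_linear.

End Localization.

Section LocalizationMap.
Variables (S : mulrClosed R) (V W : lmodType R) (f : {linear V -> W}).

Let locf (x : loc S V) : loc S W := frac (f (repr x).1) (repr x).2.

Fact loc_map_frac v s : locf (frac v s) = frac (f v) s.
Proof.
rewrite /locf; have [[v' s'] [-> /fracP[u uS /= e]]] := frac_repr v s.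
apply/fracP; exists u => //=.
by rewrite -!linearZ -linearB -linearZ e raddf0.
Qed.

Fact loc_map_is_linear : linear locf.
Proof.
move=> a; elim/frac_ind=> v s; elim/frac_ind=> w t.
rewrite fracZ fracD !loc_map_frac fracZ fracD.
by rewrite linearD !(linearZ_LR f).
Qed.
Definition loc_map : {linear loc S V -> loc S W} := mklin loc_map_is_linear.

Lemma loc_mapE v s : loc_map (frac v s) = frac (f v) s.
Proof. exact: loc_map_frac. Qed.
End LocalizationMap.

(* Cochain complexes. Indexing the differential by a proof of i + 1 = j, rather
   than giving it the codomain obj (i + 1), avoids casts between degrees that
   are equal but not convertible. *)
Record complex := Complex {
  obj :> int -> lmodType R;
  diff : forall i j : int, i + 1 = j -> {linear obj i -> obj j};
  diff_diff : forall (i j k : int) (e : i + 1 = j) (e' : j + 1 = k) (x : obj i),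
    diff e' (diff e x) = 0 }.
Arguments diff {c i j} e.

Section Cohomology.
Variables (C : complex) (i : int).

Definition cocycle : {pred C i} := fun x => diff (erefl (i + 1)) x == 0.

Fact cocycle_submod : submod_closed cocycle.
Proof.
split=> [|a x y /eqP dx /eqP dy]; apply/eqP; first exact: raddf0.
by rewrite linearP dx dy scaler0 addr0.
Qed.
HB.instance Definition _ :=
  GRing.isSubmodClosed.Build R (C i) cocycle cocycle_submod.

Record cocycles : Type := Cocycle { cocycle_val : C i; cocycleP : cocycle_val \in cocycle }.
HB.instance Definition _ := [isSub for cocycle_val].
HB.instance Definition _ := [Choice of cocycles by <:].
HB.instance Definition _ := [SubChoice_isSubLmodule of cocycles by <:].

Definition coboundary : {pred cocycles} := fun z =>
  `[< exists (j : int) (e : j + 1 = i) (y : C j), val z = diff e y >].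

Fact coboundary_submod : submod_closed coboundary.
Proof.
have e0 : i - 1 + 1 = i by rewrite subrK.
split=> [|a x y /asboolP[j [e [u xu]]] /asboolP[j' [e' [v yv]]]]; apply/asboolP.
  by exists (i - 1), e0, 0; rewrite [RHS]raddf0.
have ejj : j = j' by apply: (addIr 1); rewrite e.
case: _ / ejj in e' v yv *; exists j, e, (a *: u + v).
by rewrite linearP -xu (eq_irrelevance e e') -yv.
Qed.
HB.instance Definition _ :=
  GRing.isSubmodClosed.Build R cocycles coboundary coboundary_submod.

Definition cohomology : lmodType R := lquot coboundary.
End Cohomology.

Definition acyclic (C : complex) : Prop := forall i, is_zero (cohomology C i).

(* The total tensor product: (A (x) B)^k is the direct sum of the modules
   A^i (x) B^j over i + j = k, and d (a (x) b) = da (x) b + (-1)^i a (x) db. *)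
Section TensorComplex.
Variables A B : complex.

Definition bidegree (k : int) : choiceType := {ij : int * int | ij.1 + ij.2 == k}.

Definition tot_obj (k : int) : lmodType R :=
  dsum (fun s : bidegree k => tens (A (val s).1) (B (val s).2)).

Definition tot_in (k i j : int) (e : i + j = k) : {linear tens (A i) (B j) -> tot_obj k} :=
  @dsum_in (bidegree k) (fun s => tens (A (val s).1) (B (val s).2))
    (exist _ (i, j) (introT eqP e)).

Lemma tot_lin_ext (k : int) (U : lmodType R) (f g : {linear tot_obj k -> U}) :
  (forall i j (e : i + j = k) a b,
    f (tot_in e (tprod a b)) = g (tot_in e (tprod a b))) -> f =1 g.
Proof.
move=> fg; apply: dsum_lin_ext => -[[i j] eij] t.
have e : i + j = k by exact/eqP.
have eE : eij = introT eqP e by exact: bool_irrelevance.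
subst eij; apply: (tens_lin_ext (f := f \o tot_in e) (g := g \o tot_in e)) => a b.
exact: fg.
Qed.

Definition koszul (i : int) : R := (-1) ^+ `|i|%N.

Fact tot_degl (i j k l : int) : i + j = k -> k + 1 = l -> (i + 1) + j = l.
Proof. by move=> <- <-; rewrite addrAC. Qed.
Fact tot_degr (i j k l : int) : i + j = k -> k + 1 = l -> i + (j + 1) = l.
Proof. by move=> <- <-; rewrite addrA. Qed.

Definition tot_diff_fun (k l : int) (e : k + 1 = l) (i j : int) (eij : i + j = k)
    (t : tens (A i) (B j)) : tot_obj l :=
  tot_in (tot_degl eij e) (tens_map (diff (erefl (i + 1))) idfun t)
  + koszul i *: tot_in (tot_degr eij e) (tens_map idfun (diff (erefl (j + 1))) t).

Fact tot_diff_fun_is_linear (k l : int) (e : k + 1 = l) (i j : int) (eij : i + j = k) :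
  linear (tot_diff_fun e eij).
Proof.
move=> a t u; rewrite /tot_diff_fun !linearP scalerDr addrACA.
by rewrite !scalerA mulrC.
Qed.

Definition tot_diff (k l : int) (e : k + 1 = l) : {linear tot_obj k -> tot_obj l} :=
  dsum_lift (fun s : bidegree k => mklin (tot_diff_fun_is_linear e (eqP (valP s)))).

Lemma tot_diffE (k l : int) (e : k + 1 = l) (i j : int) (eij : i + j = k) a b :
  tot_diff e (tot_in eij (tprod a b)) =
  tot_in (tot_degl eij e) (tprod (diff (erefl (i + 1)) a) b)
  + koszul i *: tot_in (tot_degr eij e) (tprod a (diff (erefl (j + 1)) b)).
Proof.
rewrite /tot_diff /tot_in dsum_lift_in /= /tot_diff_fun !tens_mapE.
by rewrite (eq_irrelevance (eqP _) eij).
Qed.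

Fact koszulS i : koszul (i + 1) = - koszul i.
Proof.
rewrite /koszul; case: i => n; first by rewrite -PoszD absz_nat addn1 exprS mulN1r.
have -> : Negz n + 1 = - n%:Z by rewrite NegzE -addn1 PoszD opprD addrNK.
by rewrite NegzE !abszN !absz_nat exprS mulN1r opprK.
Qed.

Fact tot_diff_diff (k l m : int) (e : k + 1 = l) (e' : l + 1 = m) x :
  tot_diff e' (tot_diff e x) = 0.
Proof.
pose f0 : {linear tot_obj k -> tot_obj m} := \0.
apply: (tot_lin_ext (f := tot_diff e' \o tot_diff e) (g := f0)) => i j eij a b.
rewrite -[LHS]/(tot_diff e' (tot_diff e (tot_in eij (tprod a b)))) -[RHS]/0.
rewrite tot_diffE addrC linearP !tot_diffE !diff_diff koszulS.
rewrite tprod0l tprod0r !raddf0 ?scaler0 ?add0r ?addr0 scaleNr.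
by rewrite (eq_irrelevance (tot_degr (tot_degl _ _) _) (tot_degl (tot_degr eij e) e')) subrr.
Qed.

Definition tensor : complex := Complex tot_diff_diff.
End TensorComplex.

Section KInfinity.

Definition zero_mod : lmodType R := dsum (fun _ : void => R^o).

Definition powers (x : R) : {pred R} := fun y => `[< exists n, y = x ^+ n >].

Fact powers_closed x : mulr_closed (powers x).
Proof.
split=> [|_ _ /asboolP[m ->] /asboolP[n ->]]; apply/asboolP.
  by exists 0%N; rewrite expr0.
by exists (m + n)%N; rewrite exprD.
Qed.
HB.instance Definition _ x := GRing.isMulClosed.Build R (powers x) (powers_closed x).

Definition unit_obj (i : int) : lmodType R :=
  if i is Posz 0 then R^o else zero_mod.
Definition unit_complex : complex :=
  @Complex unit_obj (fun _ _ _ => \0) (fun _ _ _ _ _ _ => erefl).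

Definition cech_obj (x : R) (i : int) : lmodType R :=
  match i with
  | Posz 0 => R^o
  | Posz 1 => loc (powers x) R^o
  | _ => zero_mod
  end.

Definition cech_diff (x : R) (i j : int) : {linear cech_obj x i -> cech_obj x j} :=
  match i, j with
  | Posz 0, Posz 1 => loc_in (powers x) R^o
  | _, _ => \0
  end.

Fact cech_diff_diff x (i j k : int) (e : i + 1 = j) (e' : j + 1 = k) (r : cech_obj x i) :
  cech_diff x j k (cech_diff x i j r) = 0.
Proof.
case: i e r => [[|[|n]]|n] e r; case: j e e' => [[|[|m]]|m] // e e'; exact: raddf0.
Qed.

Definition cech (x : R) : complex :=
  @Complex (cech_obj x) (fun i j _ => cech_diff x i j) (@cech_diff_diff x).

(* A bounded complex of flat modules, so tensoring with it needs no deriving.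
   The trailing factor R of the iterated product is the unit of (x). *)
Definition Kinf (xs : seq R) : complex :=
  foldr (fun x K => tensor (cech x) K) unit_complex xs.
End KInfinity.

Section LocalComplex.
Variables (S : mulrClosed R) (M : complex).

Fact loc_diff_diff (i j k : int) (e : i + 1 = j) (e' : j + 1 = k) (x : loc S (M i)) :
  loc_map S (diff e') (loc_map S (diff e) x) = 0.
Proof.
elim/frac_ind: x => v s; rewrite !loc_mapE diff_diff.
by apply: frac_eq; rewrite !scaler0.
Qed.

Definition loc_complex : complex :=
  @Complex (fun i => loc S (M i)) (fun i j e => loc_map S (diff e)) loc_diff_diff.
End LocalComplex.

(* The library's prime_idealr requires 1 != 0 in R; the zero ring is allowed here. *)
Record prime_ideal (P : set R) : Prop := PrimeIdeal {
  prime_ideal0 : P 0;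
  prime_idealD : forall a b, P a -> P b -> P (a + b);
  prime_idealMl : forall r a, P a -> P (r * a);
  prime_ideal1 : ~ P 1;
  prime_idealM : forall a b, P (a * b) -> P a \/ P b }.

Record spec := Spec { prime_set :> set R; primeP : prime_ideal prime_set }.

Definition prime_compl (p : spec) : {pred R} := fun s => `[< ~ prime_set p s >].

Fact prime_compl_closed p : mulr_closed (prime_compl p).
Proof.
split=> [|s t /asboolP ps /asboolP pt]; apply/asboolP.
  exact: prime_ideal1 (primeP p).
by case/(prime_idealM (primeP p)).
Qed.
HB.instance Definition _ p :=
  GRing.isMulClosed.Build R (prime_compl p) (prime_compl_closed p).

Definition supp (M : complex) : set spec :=
  [set p | forall xs : seq R, (forall x, x \in xs -> prime_set p x) ->
    exists i : int,
      ~ is_zero (cohomology (tensor (Kinf xs) (loc_complex (prime_compl p) M)) i)].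

Definition min_primes (X : set spec) : set spec :=
  [set p | X p /\ forall q : spec, X q -> q `<=` p -> q = p].

Definition ann (N : lmodType R) (m : N) : set R := [set r | r *: m = 0].

Definition wass (N : lmodType R) : set spec :=
  [set p | exists m : N, min_primes [set q : spec | ann m `<=` q] p].

Definition total_cohomology (M : complex) : lmodType R := dsum (cohomology M).

Definition dcc_primes : Prop :=
  forall P : nat -> spec, (forall n, P n.+1 `<=` P n) ->
    exists N, forall n, (N <= n)%N -> P n = P N.

(* An object of the derived category is represented by a complex, and it is
   zero there exactly when that complex is acyclic. *)
Definition supportive : Prop :=
  forall M : complex, supp M = set0 <-> acyclic M.

End Modules.

(* Main.v *)
(* By associativity, tensoring with Kinf (x :: xs) is tensoring with Kinf xs
   and then with R -> R_x; the latter produces the fibre T of N -> N_x.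
   Suppose that H^n(N) has a nonzero class killed by powers of every x in X,
   and that in degrees i < n every class is killed by powers of every x in X.
   Then H^(i-1)(N)_x = 0 for i <= n, so H^i(T) embeds in H^i(N), and T has the
   same property in the same degree; hence H^n(Kinf xs (x) N) <> 0 for all xs
   in X. With N = M_p and X = p this gives (1), where H^i(M) = 0 for i < n, and
   (2), where minimality of p makes all of H(M_p) torsion. Minimal primes are
   produced by Zorn's lemma on multiplicative sets. *)

Require Import Defs.
From HB Require Import structures.
From mathcomp Require Import all_boot all_order all_algebra.
From mathcomp Require Import boolp classical_sets.
From mathcomp Require Import ring cardinality.

Set Implicit Arguments.
Unset Strict Implicit.
Unset Printing Implicit Defensive.

Import Order.TTheory GRing.Theory Num.Theory.
Local Open Scope classical_set_scope.
Local Open Scope ring_scope.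

(** * Associativity of the tensor product of complexes *)

Section TotalLift.
Variables (R : comPzRingType) (A B : complex R) (k : int) (U : lmodType R).
Variable F : forall i j : int, i + j = k -> {linear tens (A i) (B j) -> U}.

Definition tot_lift : {linear tot_obj A B k -> U} :=
  dsum_lift (fun s : bidegree k => F (eqP (valP s))).

Lemma tot_liftE i j (e : i + j = k) t : tot_lift (tot_in A B e t) = F e t.
Proof.
rewrite /tot_lift /tot_in dsum_lift_in.
by congr (F _ t); exact: eq_irrelevance.
Qed.
End TotalLift.

Section TensorAssociativity.
Variables (R : comPzRingType) (A B C : complex R).

Definition assocr_gen (i j m k : int) (e : i + j + m = k)
    (a : A i) (b : B j) (c : C m) : tot_obj A (tensor B C) k :=
  tot_in A (tensor B C) (etrans (addrA i j m) e)
    (tprod a (tot_in B C (erefl (j + m)) (tprod b c) : tensor B C (j + m))).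

Fact assocr_gen_linl k i j m (e : i + j + m = k) b c :
  linear (fun a => assocr_gen e a b c).
Proof. by move=> r a a'; rewrite /assocr_gen tprodDl tprodZl linearP. Qed.

Fact assocr_gen_linm k i j m (e : i + j + m = k) a c :
  linear (fun b => assocr_gen e a b c).
Proof.
by move=> r b b'; rewrite /assocr_gen tprodDl tprodZl linearP tprodDr tprodZr linearP.
Qed.

Fact assocr_gen_linr k i j m (e : i + j + m = k) a b :
  linear (fun c => assocr_gen e a b c).
Proof.
by move=> r c c'; rewrite /assocr_gen tprodDr tprodZr linearP tprodDr tprodZr linearP.
Qed.

Fact assocr_deg (i j l m k : int) : i + j = l -> l + m = k -> i + j + m = k.
Proof. by move=> ->. Qed.

(** The isomorphism is built by fixing one variable at a time: with [c] fixed, only a map out of the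
    total complex of A and B has to be given. Linearity in [c] is then checked on generators. *)
Definition assocr_slice (l m k : int) (e : l + m = k) (c : C m) :
    {linear tot_obj A B l -> tot_obj A (tensor B C) k} :=
  tot_lift (fun i j (eij : i + j = l) =>
    tens_lift (fun b => assocr_gen_linl (assocr_deg eij e) b c)
              (fun a => assocr_gen_linm (assocr_deg eij e) a c)).

Lemma assocr_sliceE l m k (e : l + m = k) c i j (eij : i + j = l) a b :
  assocr_slice e c (tot_in A B eij (tprod a b)) = assocr_gen (assocr_deg eij e) a b c.
Proof. by rewrite /assocr_slice tot_liftE tens_liftE. Qed.

Fact assocr_slice_linr l m k (e : l + m = k) t : linear (fun c => assocr_slice e c t).
Proof.
move=> r c c'.
have hl : linear (fun t => r *: assocr_slice e c t + assocr_slice e c' t).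
  move=> a x y; rewrite (linearP (assocr_slice e c)) (linearP (assocr_slice e c')).
  by rewrite !scalerDr addrACA !scalerA (mulrC r a).
apply: (tot_lin_ext (f := assocr_slice e (r *: c + c')) (g := mklin hl)) => i j eij a b.
rewrite -[RHS]/(r *: assocr_slice e c (tot_in A B eij (tprod a b)) +
  assocr_slice e c' (tot_in A B eij (tprod a b))).
by rewrite !assocr_sliceE assocr_gen_linr.
Qed.

Definition assocr (k : int) :
    {linear tensor (tensor A B) C k -> tensor A (tensor B C) k} :=
  @tot_lift R (tensor A B) C k (tot_obj A (tensor B C) k) (fun l m (e : l + m = k) =>
    tens_lift (fun c a x y => linearP (assocr_slice e c) a x y)
              (fun t => assocr_slice_linr e t)).

(** The intermediate degree [q] and all equality proofs are left free. After a differential the same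
    degree occurs both as [j + m + 1] and as [j + (m + 1)], and the formula must match either
    form. *)
Lemma assocrE k l m (e : l + m = k) i j (eij : i + j = l)
   q (e1 : j + m = q) (e2 : i + q = k) a b c :
  assocr k (tot_in (tensor A B) C e
    (tprod (tot_in A B eij (tprod a b) : tensor A B l) c)) =
  tot_in A (tensor B C) e2 (tprod a (tot_in B C e1 (tprod b c) : tensor B C q)).
Proof.
rewrite /assocr tot_liftE tens_liftE assocr_sliceE /assocr_gen; subst q.
by rewrite (eq_irrelevance (etrans _ _) e2).
Qed.

Definition assocl_gen (i j m k : int) (e : i + (j + m) = k)
    (a : A i) (b : B j) (c : C m) : tot_obj (tensor A B) C k :=
  tot_in (tensor A B) C (etrans (esym (addrA i j m)) e)
    (tprod (tot_in A B (erefl (i + j)) (tprod a b) : tensor A B (i + j)) c).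

Fact assocl_gen_linl k i j m (e : i + (j + m) = k) b c :
  linear (fun a => assocl_gen e a b c).
Proof.
by move=> r a a'; rewrite /assocl_gen tprodDl tprodZl linearP tprodDl tprodZl linearP.
Qed.

Fact assocl_gen_linm k i j m (e : i + (j + m) = k) a c :
  linear (fun b => assocl_gen e a b c).
Proof.
by move=> r b b'; rewrite /assocl_gen tprodDr tprodZr linearP tprodDl tprodZl linearP.
Qed.

Fact assocl_gen_linr k i j m (e : i + (j + m) = k) a b :
  linear (fun c => assocl_gen e a b c).
Proof. by move=> r c c'; rewrite /assocl_gen tprodDr tprodZr linearP. Qed.

Fact assocl_deg (i j l m k : int) : j + m = l -> i + l = k -> i + (j + m) = k.
Proof. by move=> ->. Qed.

Definition assocl_slice (i l k : int) (e : i + l = k) (a : A i) :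
    {linear tot_obj B C l -> tot_obj (tensor A B) C k} :=
  tot_lift (fun j m (ejm : j + m = l) =>
    tens_lift (fun c => assocl_gen_linm (assocl_deg ejm e) a c)
              (fun b => assocl_gen_linr (assocl_deg ejm e) a b)).

Lemma assocl_sliceE i l k (e : i + l = k) a j m (ejm : j + m = l) b c :
  assocl_slice e a (tot_in B C ejm (tprod b c)) = assocl_gen (assocl_deg ejm e) a b c.
Proof. by rewrite /assocl_slice tot_liftE tens_liftE. Qed.

Fact assocl_slice_linl i l k (e : i + l = k) t : linear (fun a => assocl_slice e a t).
Proof.
move=> r a a'.
have hl : linear (fun t => r *: assocl_slice e a t + assocl_slice e a' t).
  move=> s x y; rewrite (linearP (assocl_slice e a)) (linearP (assocl_slice e a')).
  by rewrite !scalerDr addrACA !scalerA (mulrC r s).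
apply: (tot_lin_ext (f := assocl_slice e (r *: a + a')) (g := mklin hl)) => j m ejm b c.
rewrite -[RHS]/(r *: assocl_slice e a (tot_in B C ejm (tprod b c)) +
  assocl_slice e a' (tot_in B C ejm (tprod b c))).
by rewrite !assocl_sliceE assocl_gen_linl.
Qed.

Definition assocl (k : int) :
    {linear tensor A (tensor B C) k -> tensor (tensor A B) C k} :=
  @tot_lift R A (tensor B C) k (tot_obj (tensor A B) C k) (fun i l (e : i + l = k) =>
    tens_lift (fun t => assocl_slice_linl e t)
              (fun a s x y => linearP (assocl_slice e a) s x y)).

Lemma assoclE k i q (e2 : i + q = k) j m (e1 : j + m = q)
   l (eij : i + j = l) (e : l + m = k) a b c :
  assocl k (tot_in A (tensor B C) e2 (tprod a (tot_in B C e1 (tprod b c) : tensor B C q))) =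
  tot_in (tensor A B) C e (tprod (tot_in A B eij (tprod a b) : tensor A B l) c).
Proof.
rewrite /assocl tot_liftE tens_liftE assocl_sliceE /assocl_gen; subst l.
by rewrite (eq_irrelevance (etrans _ _) e).
Qed.

Lemma tens_totl_ext l m (U : lmodType R) (f g : {linear tens (tensor A B l) (C m) -> U}) :
  (forall i j (e : i + j = l) a b c,
    f (tprod (tot_in A B e (tprod a b) : tensor A B l) c) =
    g (tprod (tot_in A B e (tprod a b) : tensor A B l) c)) -> f =1 g.
Proof.
move=> fg; apply: tens_lin_ext => t c.
have hl (h : {linear tens (tensor A B l) (C m) -> U}) :
    linear (fun t : tot_obj A B l => h (tprod (t : tensor A B l) c)).
  by move=> r x y; rewrite tprodDl tprodZl linearP.
by apply: (tot_lin_ext (f := mklin (hl f)) (g := mklin (hl g))) => i j e a b; exact: fg.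
Qed.

Lemma tens_totr_ext i q (U : lmodType R) (f g : {linear tens (A i) (tensor B C q) -> U}) :
  (forall j m (e : j + m = q) a b c,
    f (tprod a (tot_in B C e (tprod b c) : tensor B C q)) =
    g (tprod a (tot_in B C e (tprod b c) : tensor B C q))) -> f =1 g.
Proof.
move=> fg; apply: tens_lin_ext => a t.
have hl (h : {linear tens (A i) (tensor B C q) -> U}) :
    linear (fun t : tot_obj B C q => h (tprod a (t : tensor B C q))).
  by move=> r x y; rewrite tprodDr tprodZr linearP.
by apply: (tot_lin_ext (f := mklin (hl f)) (g := mklin (hl g))) => j m e b c; exact: fg.
Qed.

Lemma tot_totl_ext k (U : lmodType R) (f g : {linear tensor (tensor A B) C k -> U}) :
  (forall l m (e : l + m = k) i j (eij : i + j = l) a b c,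
    f (tot_in (tensor A B) C e (tprod (tot_in A B eij (tprod a b) : tensor A B l) c)) =
    g (tot_in (tensor A B) C e (tprod (tot_in A B eij (tprod a b) : tensor A B l) c))) ->
  f =1 g.
Proof.
move=> fg; apply: tot_lin_ext => l m e t c.
apply: (tens_totl_ext (f := f \o tot_in (tensor A B) C e)
  (g := g \o tot_in (tensor A B) C e)).
by move=> i j eij a b c'; exact: fg.
Qed.

Lemma tot_totr_ext k (U : lmodType R) (f g : {linear tensor A (tensor B C) k -> U}) :
  (forall i q (e : i + q = k) j m (ejm : j + m = q) a b c,
    f (tot_in A (tensor B C) e (tprod a (tot_in B C ejm (tprod b c) : tensor B C q))) =
    g (tot_in A (tensor B C) e (tprod a (tot_in B C ejm (tprod b c) : tensor B C q)))) ->
  f =1 g.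
Proof.
move=> fg; apply: tot_lin_ext => i q e a t.
apply: (tens_totr_ext (f := f \o tot_in A (tensor B C) e)
  (g := g \o tot_in A (tensor B C) e)).
by move=> j m ejm a' b c; exact: fg.
Qed.

Lemma assocrK k : cancel (assocr k) (assocl k).
Proof.
move=> t; apply: (tot_totl_ext (f := assocl k \o assocr k) (g := idfun)).
move=> l m e i j eij a b c.
have e2 : i + (j + m) = k by rewrite addrA eij.
rewrite -[LHS]/(assocl k (assocr k _)) -[RHS]/(tot_in _ _ _ _).
by rewrite (assocrE e eij (erefl _) e2) (assoclE e2 _ eij e).
Qed.

Lemma assoclK k : cancel (assocl k) (assocr k).
Proof.
move=> t; apply: (tot_totr_ext (f := assocr k \o assocl k) (g := idfun)).
move=> i q e j m ejm a b c.
have e2 : i + j + m = k by rewrite -addrA ejm.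
rewrite -[LHS]/(assocr k (assocl k _)) -[RHS]/(tot_in _ _ _ _).
by rewrite (assoclE e ejm (erefl _) e2) (assocrE e2 _ ejm e).
Qed.

Lemma koszulD (i j : int) : koszul R (i + j) = koszul R i * koszul R j.
Proof.
suff h (n : nat) (j' : int) : koszul R (n%:Z + j') = koszul R n%:Z * koszul R j'.
  case: i => n; first exact: h.
  (* The sign depends only on the absolute value. Shifting [j] by [n.+1] reduces a negative [i] to
     the case [h], since the square of a sign is 1. *)
  have eK : koszul R (Negz n) = koszul R n.+1%:Z by [].
  have {2}-> : j = n.+1%:Z + (Negz n + j) by rewrite NegzE addrA subrr add0r.
  rewrite h mulrA eK -exprD addnn -signr_odd odd_double expr0.
  by rewrite mul1r.
elim: n j' => [|n IH] j'; first by rewrite add0r mul1r.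
have -> : n.+1%:Z = n%:Z + 1 by rewrite -addn1 PoszD.
by rewrite addrAC !koszulS IH mulNr.
Qed.

End TensorAssociativity.
Lemma tensor_diffE (R : comPzRingType) (A B : complex R) (k l : int)
    (e : k + 1 = l) (i j : int) (eij : i + j = k) (a : A i) (b : B j) :
  diff (tensor A B) e (tot_in A B eij (tprod a b)) =
  tot_in A B (tot_degl eij e) (tprod (diff A (erefl (i + 1)) a) b)
  + koszul R i *: tot_in A B (tot_degr eij e) (tprod a (diff B (erefl (j + 1)) b)).
Proof. exact: tot_diffE. Qed.

Lemma assocr_diff (R : comPzRingType) (A B C : complex R) (k l : int)
    (e : k + 1 = l) (t : tensor (tensor A B) C k) :
  assocr A B C l (diff _ e t) = diff (tensor A (tensor B C)) e (assocr A B C k t).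
Proof.
apply: (tot_totl_ext (f := assocr A B C l \o diff (tensor (tensor A B) C) e)
  (g := diff (tensor A (tensor B C)) e \o assocr A B C k)) => p m epm i j eij a b c.
have e2 : i + (j + m) = k by rewrite addrA eij.
rewrite -[LHS]/(assocr A B C l (diff _ e _)).
rewrite -[RHS]/(diff (tensor A (tensor B C)) e (assocr A B C k _)).
rewrite (assocrE epm eij (erefl _) e2) !tensor_diffE.
rewrite tprodDl tprodZl.
rewrite tprodDr tprodZr.
rewrite (linearD (assocr A B C l)) (linearZ_LR (assocr A B C l)).
rewrite (linearD (tot_in (tensor A B) C (tot_degl epm e))).
rewrite (linearZ_LR (tot_in (tensor A B) C (tot_degl epm e))).
rewrite (linearD (assocr A B C l)).
rewrite (linearZ_LR (assocr A B C l)).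
rewrite (linearD (tot_in A (tensor B C) (tot_degr e2 e))).
rewrite (linearZ_LR (tot_in A (tensor B C) (tot_degr e2 e))).
rewrite (assocrE _ _ (erefl _) (tot_degl e2 e)).
rewrite (assocrE _ _ (tot_degl (erefl (j + m)) (erefl (j + m + 1))) (tot_degr e2 e)).
rewrite (assocrE _ _ (tot_degr (erefl (j + m)) (erefl (j + m + 1))) (tot_degr e2 e)).
(* The three summands now agree up to signs; the one containing dc carries the sign of [p] on the
   left and the product of the signs of [i] and [j] on the right, with [i + j = p]. *)
by rewrite scalerDr addrA scalerA -koszulD eij.
Qed.

(** * Localization fibres *)

Section LocalizationFacts.
Variables (R : comPzRingType) (S : mulrClosed R).

Lemma frac_eq0 (V : lmodType R) (v : V) (s : denom S) :
  Defs.frac v s = 0 <-> exists2 u, u \in S & u *: v = 0.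
Proof.
have z0 : 0 = Defs.frac (0 : V) (denom1 S) by [].
rewrite {1}z0; split=> [/fracP[u uS /=]|[u uS uv]].
  by rewrite scaler0 subr0 scale1r => uv; exists u.
by apply/fracP; exists u => //=; rewrite scaler0 subr0 scale1r.
Qed.

Lemma frac_simpl (V : lmodType R) (u : R) (hu : u \in S) (v : V) (s : denom S) :
  Defs.frac (u *: v) (denomM (exist (fun u => u \in S) u hu) s) = Defs.frac v s.
Proof. by apply: frac_eq; rewrite /= scalerA mulrC. Qed.
End LocalizationFacts.

Section Boundaries.
Variables (R : comPzRingType) (C : complex R).

Definition bounds (i : int) (z : C i) : Prop :=
  exists (j : int) (e : j + 1 = i) (y : C j), z = diff C e y.

(** The degree [j] is determined by [i] and proofs of integer equalities are unique, so any
    convenient form of the predecessor, such as [i - 1], may be used. *)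
Lemma boundsP (i j : int) (e : j + 1 = i) (z : C i) :
  bounds z <-> exists y : C j, z = diff C e y.
Proof.
split=> [[j' [e' [y ->]]]|[y ->]]; last by exists j, e, y.
have ejj : j' = j by apply: (addIr 1); rewrite e.
by subst j'; exists y; rewrite (eq_irrelevance e' e).
Qed.

Definition power_torsion_cocycle (X : set R) (i : int) (z : C i) : Prop :=
  forall x, X x -> exists k, bounds (x ^+ k *: z).

Definition power_torsion_at (X : set R) (i : int) : Prop :=
  forall z : C i, diff C (erefl (i + 1)) z = 0 -> power_torsion_cocycle X z.

(** The invariant of the induction on the sequence, phrased with cocycles so that no quotient has to
    be opened when complexes are compared. *)
Definition torsion_detected (X : set R) (n : int) : Prop :=
  (forall i, i < n -> power_torsion_at X i) /\
  exists z : C n, [/\ diff C (erefl (n + 1)) z = 0, ~ bounds z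
    & power_torsion_cocycle X z].
End Boundaries.

Section ChainIso.
Variables (R : comPzRingType) (A B : complex R).
Variables (f : forall k, {linear A k -> B k}) (g : forall k, B k -> A k).
Hypotheses (fK : forall k, cancel (@f k) (@g k)) (gK : forall k, cancel (@g k) (@f k)).
Hypothesis f_diff : forall k l (e : k + 1 = l) t, f l (diff A e t) = diff B e (f k t).

Lemma iso_bounds k (t : A k) : bounds t <-> bounds (f k t).
Proof.
have e : k - 1 + 1 = k by rewrite subrK.
split=> /(boundsP e)[y ty]; apply/(boundsP e).
  by exists (f _ y); rewrite ty f_diff.
by exists (g y); apply: (can_inj (@fK k)); rewrite f_diff gK.
Qed.

Lemma iso_torsion_detected (X : set R) (n : int) :
  torsion_detected B X n -> torsion_detected A X n.
Proof.
move=> [tors [z [dz nbz tz]]]; split=> [i lt_in t dt x Xx|].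
  have [|k bk] := tors i lt_in (f i t) _ x Xx; first by rewrite -f_diff dt raddf0.
  by exists k; apply/iso_bounds; rewrite linearZ.
exists (g z); split.
- by apply: (can_inj (@fK _)); rewrite f_diff gK dz raddf0.
- by move/iso_bounds; rewrite gK.
- by move=> x /tz[k bk]; exists k; apply/iso_bounds; rewrite linearZ gK.
Qed.
End ChainIso.

Section LocalizationFiber.
Variables (R : comPzRingType) (x : R) (T N : complex R).
(** Abstract form of the fibre of N -> N_x: [pi0] and [pi1] identify T^k with pairs (a, b) in N^k
    and (N^l)_x, where l + 1 = k, and the differential is d(a, b) = (da, a/1 - db). *)
Variable pi0 : forall k, {linear T k -> N k}.
Variable pi1 : forall k l, l + 1 = k -> {linear T k -> loc (powers x) (N l)}.
Hypothesis pi_inj : forall k l (e : l + 1 = k) t, pi0 k t = 0 -> pi1 e t = 0 -> t = 0.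
Hypothesis pi_surj : forall k l (e : l + 1 = k) a b,
  exists t, pi0 k t = a /\ pi1 e t = b.
Hypothesis pi0_diff : forall k l (e : k + 1 = l) t, pi0 l (diff T e t) = diff N e (pi0 k t).
Hypothesis pi1_diff : forall k l m (e : l + 1 = k) (e' : k + 1 = m) t,
  pi1 e' (diff T e' t) =
  loc_in (powers x) (N k) (pi0 k t) - loc_map (powers x) (diff N e) (pi1 e t).

(** The kernel of H^k(T) -> H^k(N) comes from H^l(N_x) = H^l(N)_x, which vanishes when every class
    of H^l(N) is killed by a power of x. The proof follows this argument on elements. *)
Lemma fiber_bounds (k l : int) (e : l + 1 = k) (t : T k) :
  power_torsion_at N [set x] l -> diff T (erefl (k + 1)) t = 0 ->
  bounds (pi0 k t) -> bounds t.
Proof.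
move=> tors dt /(boundsP e)[a ta].
have e2 : l - 1 + 1 = l by rewrite subrK.
have [s [s0 s1]] := pi_surj e2 a 0.
(* Subtracting d(a, 0) leaves a cocycle with first component 0, so its second component is a cocycle
   of N_x. *)
pose t1 := t - diff T e s.
have t10 : pi0 k t1 = 0 by rewrite linearB pi0_diff s0 ta subrr.
have dt1 : diff T (erefl (k + 1)) t1 = 0 by rewrite linearB dt diff_diff subrr.
have: loc_map (powers x) (diff N e) (pi1 e t1) = 0.
  have := pi1_diff e (erefl (k + 1)) t1.
  by rewrite dt1 t10 !raddf0 sub0r => /eqP; rewrite eq_sym oppr_eq0 => /eqP.
have [b] : exists b, b = pi1 e t1 by exists (pi1 e t1).
elim/frac_ind: b => c w cw; rewrite -cw loc_mapE => /frac_eq0[u uS].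
rewrite -linearZ => duc.
have {}duc : diff N (erefl (l + 1)) (u *: c) = 0 by subst k; exact: duc.
(* Torsion turns the cocycle uc into x^r u c = dc', so c/w = d(c'/(x^r u w)). The minus sign in
   front of [c'] below cancels the one in d(a, b). *)
have [r /(boundsP e2)[c' cc']] := tors _ duc x erefl.
have xrS : x ^+ r * u \in powers x.
  by rewrite rpredM //; apply/asboolP; exists r.
pose xr : denom (powers x) := exist (fun u => u \in powers x) _ xrS.
have [s' [s'0 s'1]] := pi_surj e2 0 (Defs.frac (- c') (denomM xr w)).
apply/(boundsP e); exists (s + s'); apply/eqP; rewrite -subr_eq0 linearD opprD addrA.
apply/eqP/(pi_inj (e := e)).
  by rewrite linearB -/t1 t10 pi0_diff s'0 raddf0 subrr.
have dc' : diff N e2 (- c') = (x ^+ r * u) *: (- c).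
  by rewrite scalerN -scalerA cc' raddfN.
rewrite linearB -/t1 -cw (pi1_diff e2 e) s'0 s'1 raddf0 sub0r opprK loc_mapE.
by rewrite dc' frac_simpl -scaleN1r -fracZ scaleN1r subrr.
Qed.

(** By injectivity, whatever kills the image of a class in H^i(N) kills the class in H^i(T). For
    [i <= n] this uses torsion of N only in degree [i - 1], which is below [n]. *)
Lemma fiber_torsion_detected (X : set R) (n : int) : X x ->
  torsion_detected N X n -> torsion_detected T X n.
Proof.
move=> Xx [tors [z [dz nbz tz]]].
have pi0_cocycle i (t : T i) : diff T (erefl (i + 1)) t = 0 ->
    diff N (erefl (i + 1)) (pi0 i t) = 0.
  by move=> dt; rewrite -pi0_diff dt raddf0.
have lift i (t : T i) : i <= n -> diff T (erefl (i + 1)) t = 0 ->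
    power_torsion_cocycle X (pi0 i t) -> power_torsion_cocycle X t.
  move=> le_in dt tt y /tt[k]; rewrite -linearZ => bk; exists k.
  apply: (fiber_bounds (subrK 1 i)) bk; last by rewrite linearZ /= dt scaler0.
  move=> c dc _ ->; apply: tors dc _ Xx.
  by apply: lt_le_trans le_in; rewrite ltrBlDr ltzD1.
split=> [i lt_in t dt|].
  by apply: lift => //; [exact: ltW | apply: tors => //; exact: pi0_cocycle].
have e : n - 1 + 1 = n by rewrite subrK.
have [k /(boundsP e)[w xz]] := tz x Xx.
have xkS : x ^+ k \in powers x by apply/asboolP; exists k.
(* Since x^k z = dw, the pair (z, w/x^k) is a cocycle of T lifting z; it is no coboundary because z
   is none. *)
have [t [t0 t1]] := pi_surj e z (Defs.frac w (exist (fun u => u \in powers x) _ xkS)).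
have dt : diff T (erefl (n + 1)) t = 0.
  apply: (pi_inj (e := erefl (n + 1))); first by rewrite pi0_diff t0.
  rewrite (pi1_diff e) t0 t1.
  suff <- : loc_in (powers x) (N n) z = loc_map (powers x) (diff N e)
      (Defs.frac w (exist (fun u => u \in powers x) _ xkS)) by rewrite subrr.
  by rewrite loc_mapE; apply: frac_eq; rewrite /= scale1r; exact: xz.
exists t; split=> //.
  move=> /(boundsP e)[s ts]; apply: nbz; apply/(boundsP e); exists (pi0 _ s).
  by rewrite -pi0_diff -ts.
by apply: lift; rewrite // t0.
Qed.
End LocalizationFiber.

(** * Tensoring with the Cech complex of one element *)

Lemma zero_mod_eq0 (R : comPzRingType) (v : zero_mod R) : v = 0.
Proof. by apply: dsumP => -[]. Qed.

(** In the summand of bidegree (0, j) of total degree k, the degrees j and k are equal but not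
    convertible; this transport lets the components land in [N k]. *)
Definition degree_cast (R : comPzRingType) (C : complex R) (i j : int) (e : i = j) :
    {linear C i -> C j} :=
  match e in _ = k return {linear C i -> C k} with erefl => idfun end.

Lemma degree_cast_id (R : comPzRingType) (C : complex R) (i : int) (e : i = i) a :
  degree_cast C e a = a.
Proof. by rewrite (eq_irrelevance e erefl). Qed.

Section CechTensor.
Variables (R : comPzRingType) (x : R) (N : complex R).

Section Components.
Variables (j k : int) (e : j = k).

Fact scale_cast_linl a : linear (fun r : R^o => r *: degree_cast N e a).
Proof. exact: scale_gen_is_linear. Qed.

Fact scale_cast_linr (r : R^o) : linear (fun a => r *: degree_cast N e a).
Proof. by move=> s a b; rewrite linearP scalerDr !scalerA mulrC. Qed.

Definition scale_cast (a : N j) : {linear R^o -> N k} := mklin (scale_cast_linl a).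

Fact loc_scale_cast_linr q : linear (fun a => loc_map (powers x) (scale_cast a) q).
Proof.
elim/frac_ind: q => r s c a b.
have locE a' : loc_map (powers x) (scale_cast a') (Defs.frac r s) =
    Defs.frac ((r : R) *: degree_cast N e a') s by exact: loc_mapE.
rewrite !locE fracZ fracD; apply: frac_eq => /=.
rewrite linearP !scalerDr !scalerA.
by congr (_ *: _ + _ *: _); ring.
Qed.
End Components.

Fact cech_deg0 (j k : int) : 0 + j = k -> j = k. Proof. by rewrite add0r. Qed.
Fact cech_deg1 (j k l : int) : l + 1 = k -> 1 + j = k -> j = l.
Proof. by move=> <-; rewrite addrC => /addIr. Qed.

Definition cech_comp0 (k i j : int) : i + j = k -> {linear tens (cech x i) (N j) -> N k} :=
  match i as i return i + j = k -> {linear tens (cech x i) (N j) -> N k} with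
  | Posz 0 => fun e => tens_lift (scale_cast_linl (cech_deg0 e)) (scale_cast_linr (cech_deg0 e))
  | _ => fun _ => \0
  end.

(** In degree 1 this is the action R_x (x) N^l -> (N^l)_x, obtained by localising the map sending r
    to ra. *)
Definition cech_comp1 (k l : int) (el : l + 1 = k) (i j : int) :
    i + j = k -> {linear tens (cech x i) (N j) -> loc (powers x) (N l)} :=
  match i as i return i + j = k -> {linear tens (cech x i) (N j) -> loc (powers x) (N l)} with
  | Posz 1 => fun e =>
      tens_lift (fun a => linearP (loc_map (powers x) (scale_cast (cech_deg1 el e) a)))
                (loc_scale_cast_linr (cech_deg1 el e))
  | _ => fun _ => \0
  end.

Definition cech_pi0 (k : int) : {linear tensor (cech x) N k -> N k} :=
  @tot_lift R (cech x) N k (N k) (@cech_comp0 k).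
Definition cech_pi1 (k l : int) (e : l + 1 = k) :
    {linear tensor (cech x) N k -> loc (powers x) (N l)} :=
  @tot_lift R (cech x) N k (loc (powers x) (N l)) (@cech_comp1 k l e).

Lemma cech_pi0E k j (e : 0 + j = k) (e' : j = k) (r : cech x 0) a :
  cech_pi0 k (tot_in (cech x) N e (tprod r a)) = (r : R) *: degree_cast N e' a.
Proof.
rewrite /cech_pi0 tot_liftE /cech_comp0 tens_liftE.
by rewrite (eq_irrelevance (cech_deg0 e) e').
Qed.

Lemma cech_pi0_neq0 k i j (e : i + j = k) t : i != 0 ->
  cech_pi0 k (tot_in (cech x) N e t) = 0.
Proof.
by rewrite /cech_pi0 tot_liftE; case: i e t => [[|i]|i] e t.
Qed.

Lemma cech_pi1E k l (el : l + 1 = k) j (e : 1 + j = k) (e' : j = l) (r : R) s a :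
  cech_pi1 el (tot_in (cech x) N e (tprod (Defs.frac (r : R^o) s : cech x 1) a)) =
  Defs.frac (r *: degree_cast N e' a) s.
Proof.
rewrite /cech_pi1 tot_liftE /cech_comp1 tens_liftE.
rewrite -[LHS]/(loc_map (powers x) (scale_cast (cech_deg1 el e) a) (Defs.frac (r : R^o) s)).
rewrite loc_mapE -[scale_cast _ _ _]/(r *: degree_cast N (cech_deg1 el e) a).
by rewrite (eq_irrelevance (cech_deg1 el e) e').
Qed.

Lemma cech_pi1_neq1 k l (el : l + 1 = k) i j (e : i + j = k) t : i != 1 ->
  cech_pi1 el (tot_in (cech x) N e t) = 0.
Proof.
by rewrite /cech_pi1 tot_liftE; case: i e t => [[|[|i]]|i] e t.
Qed.
End CechTensor.

Section CechTensorFiber.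
Variables (R : comPzRingType) (x : R) (N : complex R).
Local Notation T := (tensor (cech x) N).
Local Notation pi0 := (cech_pi0 x N).
Local Notation pi1 := (cech_pi1 x N).

Definition cech_in0 (k : int) (a : N k) : T k :=
  tot_in (cech x) N (add0r k) (tprod (1 : R^o) a : tens (cech x 0) (N k)).

Fact cech_in0_is_linear k : linear (@cech_in0 k).
Proof. by move=> r a b; rewrite /cech_in0 tprodDr tprodZr linearP. Qed.

Fact cech_deg1r (k l : int) : l + 1 = k -> 1 + l = k.
Proof. by rewrite addrC. Qed.

Lemma frac1Z (r : R) (s : denom (powers x)) :
  r *: Defs.frac (1 : R^o) s = Defs.frac (r : R^o) s.
Proof. by rewrite fracZ; congr Defs.frac; rewrite -[LHS]/(r * 1) mulr1. Qed.

(** Inverse of the isomorphism R_x (x) N^l -> (N^l)_x, written with a chosen representative;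
    [loc_tensE] shows that the choice does not matter. *)
Definition loc_tens (l : int) (b : loc (powers x) (N l)) :
    tens (loc (powers x) R^o) (N l) :=
  tprod (Defs.frac (1 : R^o) (repr b).2) (repr b).1.

Lemma loc_tensE l (c : N l) s :
  loc_tens (Defs.frac c s) = tprod (Defs.frac (1 : R^o) s) c.
Proof.
rewrite /loc_tens; have [[c' s'] [-> /fracP[u uS /= e]]] := frac_repr c s.
move: e; rewrite scalerBr !scalerA => /subr0_eq e.
(* Over the common denominator u s s', both 1/s and 1/s' are multiples of 1/d, and the scalars cross
   the tensor sign to meet the relation u s c' = u s' c. *)
pose d := denomM (exist (fun u => u \in powers x) u uS) (denomM s s').
have -> : Defs.frac (1 : R^o) s' = (u * sval s) *: Defs.frac (1 : R^o) d.
  by rewrite fracZ; apply: frac_eq; rewrite /= /GRing.scale /=; ring.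
have -> : Defs.frac (1 : R^o) s = (u * sval s') *: Defs.frac (1 : R^o) d.
  by rewrite fracZ; apply: frac_eq; rewrite /= /GRing.scale /=; ring.
by rewrite !tprodZl -!tprodZr e.
Qed.

Fact loc_tens_is_linear l : linear (@loc_tens l).
Proof.
move=> r; elim/frac_ind=> b s; elim/frac_ind=> c t.
rewrite fracZ fracD !loc_tensE tprodDr.
rewrite !tprodZr -!tprodZl !scalerA !frac1Z.
by congr (tprod _ _ + tprod _ _); apply: frac_eq; rewrite /= /GRing.scale /=; ring.
Qed.

Definition cech_in1 (k l : int) (e : l + 1 = k) (b : loc (powers x) (N l)) : T k :=
  tot_in (cech x) N (cech_deg1r e) (loc_tens b : tens (cech x 1) (N l)).

Fact cech_in1_is_linear k l (e : l + 1 = k) : linear (cech_in1 e).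
Proof. by move=> r a b; rewrite /cech_in1 loc_tens_is_linear linearP. Qed.

Lemma cech_in0_0 k : cech_in0 (0 : N k) = 0.
Proof. exact: (raddf0 (mklin (@cech_in0_is_linear k))). Qed.

Lemma cech_in1_0 k l (e : l + 1 = k) : cech_in1 e 0 = 0.
Proof. exact: (raddf0 (mklin (cech_in1_is_linear e))). Qed.

(** Moving numerators into N turns every generator into 1 (x) a or (1/s) (x) a; outside degrees 0
    and 1 the first factor is zero. *)
Lemma cech_tot_ext k (U : lmodType R) (f g : {linear T k -> U}) :
  (forall e a, f (tot_in (cech x) N e (tprod (1 : R^o) a : tens (cech x 0) (N k))) =
    g (tot_in (cech x) N e (tprod (1 : R^o) a : tens (cech x 0) (N k)))) ->
  (forall l (e : l + 1 = k) (e' : 1 + l = k) s a,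
    f (tot_in (cech x) N e' (tprod (Defs.frac (1 : R^o) s) a : tens (cech x 1) (N l))) =
    g (tot_in (cech x) N e' (tprod (Defs.frac (1 : R^o) s) a : tens (cech x 1) (N l)))) ->
  f =1 g.
Proof.
move=> fg0 fg1; apply: tot_lin_ext => i j e r a.
have vanish (r' : zero_mod R) : r' = 0 by exact: zero_mod_eq0.
case: i e r => [[|[|n]]|n] e r.
- have ejk : j = k by rewrite -e add0r.
  subst j; have -> : tprod r a = tprod (1 : R^o) ((r : R) *: a) :> tens (cech x 0) (N k).
    by rewrite tprodZr -tprodZl -[(r : R) *: _]/((r : R) * 1) mulr1.
  exact: fg0.
- have elk : j + 1 = k by rewrite -e addrC.
  have [v ->] : exists v : R^o * denom (powers x), r = Defs.frac v.1 v.2.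
    by elim/frac_ind: r => v s; exists (v, s).
  have -> : tprod (Defs.frac v.1 v.2) a =
      tprod (Defs.frac (1 : R^o) v.2) ((v.1 : R) *: a) :> tens (cech x 1) (N j).
    by rewrite tprodZr -tprodZl; congr tprod; exact/esym/frac1Z.
  exact: fg1.
- by rewrite (vanish r) tprod0l !raddf0.
- by rewrite (vanish r) tprod0l !raddf0.
Qed.

Lemma cech_pi0_in0 k a : pi0 k (cech_in0 a) = a.
Proof. by rewrite /cech_in0 (cech_pi0E _ erefl) degree_cast_id scale1r. Qed.

Lemma cech_pi1_in0 k l (e : l + 1 = k) a : pi1 e (cech_in0 a) = 0.
Proof. by rewrite /cech_in0 cech_pi1_neq1. Qed.

Lemma cech_pi0_in1 k l (e : l + 1 = k) b : pi0 k (cech_in1 e b) = 0.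
Proof. by rewrite /cech_in1 cech_pi0_neq0. Qed.

Lemma cech_pi1_in1 k l (e : l + 1 = k) b : pi1 e (cech_in1 e b) = b.
Proof.
elim/frac_ind: b => c s; rewrite /cech_in1 loc_tensE (cech_pi1E _ _ erefl).
by rewrite degree_cast_id scale1r.
Qed.

Lemma cech_pi_surj k l (e : l + 1 = k) a b :
  exists t, pi0 k t = a /\ pi1 e t = b.
Proof.
exists (cech_in0 a + cech_in1 e b).
by rewrite !linearD cech_pi0_in0 cech_pi1_in0 cech_pi0_in1 cech_pi1_in1 addr0 add0r.
Qed.

Lemma cech_decomp k l (e : l + 1 = k) (t : T k) :
  t = cech_in0 (pi0 k t) + cech_in1 e (pi1 e t).
Proof.
have hl : linear (fun t : T k => cech_in0 (pi0 k t) + cech_in1 e (pi1 e t)).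
  move=> r u v; rewrite (linearP (pi0 k)) (linearP (pi1 e)).
  rewrite cech_in0_is_linear cech_in1_is_linear.
  by rewrite scalerDr addrACA.
apply: (cech_tot_ext (f := idfun) (g := mklin hl)) => [e0 a|l' e1 e' s a].
  rewrite -[RHS]/(cech_in0 (pi0 k _) + cech_in1 e (pi1 e _)).
  rewrite (cech_pi0E _ erefl) degree_cast_id scale1r cech_pi1_neq1 //.
  rewrite cech_in1_0 addr0.
  by rewrite /cech_in0 (eq_irrelevance e0 (add0r k)).
have ell : l' = l by apply: (addIr 1); rewrite e.
subst l'; rewrite -[RHS]/(cech_in0 (pi0 k _) + cech_in1 e (pi1 e _)).
rewrite cech_pi0_neq0 // (cech_pi1E _ _ erefl) degree_cast_id scale1r.
rewrite cech_in0_0 add0r.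
by rewrite /cech_in1 loc_tensE (eq_irrelevance e' (cech_deg1r e)).
Qed.

Lemma cech_pi_inj k l (e : l + 1 = k) t : pi0 k t = 0 -> pi1 e t = 0 -> t = 0.
Proof.
move=> t0 t1; rewrite (cech_decomp e t) t0 t1.
rewrite cech_in0_0.
by rewrite cech_in1_0 addr0.
Qed.

Lemma cech_pi0_diff k l (e : k + 1 = l) t : pi0 l (diff T e t) = diff N e (pi0 k t).
Proof.
apply: (cech_tot_ext (f := pi0 l \o diff T e) (g := diff N e \o pi0 k))
  => [e0 a|p e1 e' s a].
  rewrite -[LHS]/(pi0 l (diff T e _)) -[RHS]/(diff N e (pi0 k _)).
  rewrite (cech_pi0E _ erefl) degree_cast_id scale1r tensor_diffE linearD.
  rewrite cech_pi0_neq0 // add0r (linearZ_LR (pi0 l)) -[koszul R 0]/(1 : R).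
  by subst l; rewrite (cech_pi0E _ erefl) degree_cast_id !scale1r.
rewrite -[LHS]/(pi0 l (diff T e _)) -[RHS]/(diff N e (pi0 k _)).
rewrite (cech_pi0_neq0 e') // raddf0 tensor_diffE linearD linearZ_LR.
by rewrite !cech_pi0_neq0 // scaler0 addr0.
Qed.

Lemma cech_pi1_diff k l m (e : l + 1 = k) (e' : k + 1 = m) t :
  pi1 e' (diff T e' t) =
  loc_in (powers x) (N k) (pi0 k t) - loc_map (powers x) (diff N e) (pi1 e t).
Proof.
have hl : linear (fun t : T k => loc_in (powers x) (N k) (pi0 k t) -
    loc_map (powers x) (diff N e) (pi1 e t)).
  move=> r u v; rewrite (linearP (pi0 k)) (linearP (loc_in _ _)).
  by rewrite (linearP (pi1 e)) (linearP (loc_map _ _)) scalerBr opprD addrACA.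
apply: (cech_tot_ext (f := pi1 e' \o diff T e') (g := mklin hl)) => [e0 a|p e1 e2 s a].
  rewrite -[LHS]/(pi1 e' (diff T e' _)) -[RHS]/(loc_in _ _ (pi0 k _) -
    loc_map _ _ (pi1 e _)).
  rewrite (cech_pi0E _ erefl) degree_cast_id scale1r (cech_pi1_neq1 e e0) // raddf0 subr0.
  rewrite tensor_diffE linearD linearZ_LR (cech_pi1_neq1 e' (tot_degr e0 e')) //.
  rewrite scaler0 addr0.
  (* The localisation map sends 1 to the fraction 1/1, which has the shape needed to evaluate
     [pi1]. *)
  rewrite -[LHS]/(pi1 e' (tot_in (cech x) N (i := 1) (tot_degl e0 e')
    (tprod (Defs.frac (1 : R^o) (denom1 (powers x)) : cech x 1) a))).
  by rewrite (cech_pi1E _ _ erefl) degree_cast_id scale1r.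
rewrite -[LHS]/(pi1 e' (diff T e' _)) -[RHS]/(loc_in _ _ (pi0 k _) -
  loc_map _ _ (pi1 e _)).
have ell : p = l by apply: (addIr 1); rewrite e.
subst p; rewrite cech_pi0_neq0 // raddf0 sub0r (cech_pi1E _ _ erefl) degree_cast_id scale1r.
rewrite loc_mapE tensor_diffE linearD linearZ_LR (cech_pi1_neq1 e' (tot_degl e2 e')) //.
rewrite add0r.
subst k; rewrite (cech_pi1E _ _ erefl) degree_cast_id scale1r.
(* The minus sign of the fibre is the Koszul sign of degree 1. *)
by rewrite -scaleN1r; congr (_ *: _); rewrite /koszul expr1.
Qed.

Lemma cech_torsion_detected (X : set R) (n : int) : X x ->
  torsion_detected N X n -> torsion_detected T X n.
Proof.
apply: fiber_torsion_detected cech_pi_surj cech_pi0_diff cech_pi1_diff _ _.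
exact: cech_pi_inj.
Qed.
End CechTensorFiber.

(** * Stable Koszul complexes, localization and support *)

Section UnitTensor.
Variables (R : comPzRingType) (N : complex R).
Local Notation T := (tensor (unit_complex R) N).

Definition unit_comp (k i j : int) :
    i + j = k -> {linear tens (unit_complex R i) (N j) -> N k} :=
  match i as i return i + j = k -> {linear tens (unit_complex R i) (N j) -> N k} with
  | Posz 0 => fun e => tens_lift (@scale_cast_linl R N j k (cech_deg0 e))
                             (@scale_cast_linr R N j k (cech_deg0 e))
  | _ => fun _ => \0
  end.

Definition unit_pi (k : int) : {linear T k -> N k} :=
  @tot_lift R (unit_complex R) N k (N k) (@unit_comp k).

Definition unit_in (k : int) (a : N k) : T k :=
  tot_in (unit_complex R) N (add0r k) (tprod (1 : R^o) a : tens (unit_complex R 0) (N k)).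

Lemma unit_inK k : cancel (@unit_in k) (unit_pi k).
Proof.
move=> a; rewrite /unit_in /unit_pi tot_liftE /unit_comp tens_liftE.
by rewrite degree_cast_id scale1r.
Qed.

Lemma unit_tot_ext k (U : lmodType R) (f g : {linear T k -> U}) :
  (forall a, f (unit_in a) = g (unit_in a)) -> f =1 g.
Proof.
move=> fg; apply: tot_lin_ext => i j e r a.
have vanish (r' : zero_mod R) : r' = 0 by exact: zero_mod_eq0.
case: i e r => [[|n]|n] e r; last 2 first.
- by rewrite (vanish r) tprod0l !raddf0.
- by rewrite (vanish r) tprod0l !raddf0.
have ejk : j = k by rewrite -e add0r.
subst j; have -> : tprod r a = tprod (1 : R^o) ((r : R) *: a) :> tens (unit_complex R 0) (N k).
  by rewrite tprodZr -tprodZl -[(r : R) *: _]/((r : R) * 1) mulr1.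
by rewrite (eq_irrelevance e (add0r k)); exact: fg.
Qed.

Lemma unit_piK k : cancel (unit_pi k) (@unit_in k).
Proof.
have hl : linear (fun t : T k => unit_in (unit_pi k t)).
  by move=> r u v; rewrite (linearP (unit_pi k)) /unit_in tprodDr tprodZr linearP.
move=> t; apply: (unit_tot_ext (f := mklin hl) (g := idfun)) => a.
by rewrite -[LHS]/(unit_in (unit_pi k _)) unit_inK.
Qed.

Lemma unit_in_diff k l (e : k + 1 = l) a :
  diff T e (unit_in a) = unit_in (diff N e a).
Proof.
rewrite tensor_diffE -[diff (unit_complex R) _ _]/(0 : unit_complex R (0 + 1)).
rewrite tprod0l raddf0 add0r -[koszul R 0]/(1 : R) scale1r.
by subst l; rewrite /unit_in (eq_irrelevance (tot_degr _ _) (add0r (k + 1))).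
Qed.

Lemma unit_pi_diff k l (e : k + 1 = l) t : unit_pi l (diff T e t) = diff N e (unit_pi k t).
Proof. by rewrite -[t in LHS]unit_piK unit_in_diff unit_inK. Qed.
End UnitTensor.

Lemma Kinf_torsion_detected (R : comPzRingType) (N : complex R) (X : set R)
    (n : int) (xs : seq R) : (forall x, x \in xs -> X x) ->
  torsion_detected N X n -> torsion_detected (tensor (Kinf xs) N) X n.
Proof.
move=> xsX tN; elim: xs xsX => [|x xs IH] xsX.
  by apply: (iso_torsion_detected (@unit_piK R N) (@unit_inK R N) (@unit_pi_diff R N)).
rewrite -[Kinf _]/(tensor (cech x) (Kinf xs)).
(* Reassociating puts the factor of [x] outermost, over a complex covered by the induction
   hypothesis. *)
apply: (iso_torsion_detected (@assocrK _ _ _ _) (@assoclK _ _ _ _)).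
  exact: assocr_diff.
apply: cech_torsion_detected; first by apply: xsX; rewrite mem_head.
by apply: IH => y yxs; apply: xsX; rewrite in_cons yxs orbT.
Qed.

Section CohomologyClasses.
Variables (R : comPzRingType) (C : complex R) (i : int).

Definition coh_class (z : C i) (dz : diff C (erefl (i + 1)) z = 0) : cohomology C i :=
  lquot_pi _ (Cocycle (introT eqP dz)).

Lemma coh_class_ex (c : cohomology C i) : exists z dz, c = @coh_class z dz.
Proof.
rewrite -[c]lquot_reprK; case: (repr c) => z zP; exists z, (elimT eqP zP).
by congr lquot_pi; apply: val_inj.
Qed.

Lemma scale_coh_class_eq0 (a : R) z dz :
  a *: @coh_class z dz = 0 <-> bounds (a *: z).
Proof.
have -> : (0 : cohomology C i) = lquot_pi (@coboundary R C i) 0 by exact/esym/raddf0.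
rewrite -linearZ; apply: (iff_trans (lquot_piP _ _ _)); rewrite subr0.
by split=> [/asboolP|bz]; last exact/asboolP.
Qed.

Lemma coh_class_eq0 z dz : @coh_class z dz = 0 <-> bounds z.
Proof. by rewrite -[coh_class _]scale1r scale_coh_class_eq0 scale1r. Qed.

Lemma cohomology_zeroP : is_zero (cohomology C i) <->
  forall z : C i, diff C (erefl (i + 1)) z = 0 -> bounds z.
Proof.
split=> [H z dz|H c]; first by apply/(coh_class_eq0 dz)/H.
by have [z [dz ->]] := coh_class_ex c; apply/coh_class_eq0/H.
Qed.
End CohomologyClasses.

Section LocalCohomology.
Variables (R : comPzRingType) (S : mulrClosed R) (M : complex R).

Lemma loc_cocycle (i : int) (v : M i) (s : denom S) :
  diff (loc_complex S M) (erefl (i + 1)) (Defs.frac v s) = 0 ->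
  exists2 u, u \in S & diff M (erefl (i + 1)) (u *: v) = 0.
Proof.
rewrite -[LHS]/(loc_map S (diff M (erefl (i + 1))) _) loc_mapE => /frac_eq0[u uS uv].
by exists u; rewrite ?linearZ.
Qed.

(** With [loc_cocycle], this is exactness of localisation on elements: denominators are cleared in
    the relation expressing v/s as a boundary. *)
Lemma loc_bounds (i : int) (v : M i) (s : denom S) :
  bounds (Defs.frac v s : loc_complex S M i) <->
  exists2 u, u \in S & bounds (u *: v).
Proof.
have e : i - 1 + 1 = i by rewrite subrK.
split=> [/(boundsP e)[y]|[u uS /(boundsP e)[y uv]]].
  rewrite -[diff _ _ _]/(loc_map S (diff M e) y); elim/frac_ind: y => y t.
  rewrite loc_mapE => /fracP[u uS]; rewrite scalerBr !scalerA => /subr0_eq uv.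
  exists (u * sval t); first by rewrite rpredM // (valP t).
  by apply/(boundsP e); exists ((u * sval s) *: y); rewrite linearZ.
apply/(boundsP e).
exists (Defs.frac y (denomM (exist (fun u => u \in S) u uS) s)).
rewrite -[RHS]/(loc_map S (diff M e) _) loc_mapE.
by apply: frac_eq; rewrite -uv scalerA mulrC.
Qed.
End LocalCohomology.

Section Support.
Variables (R : comPzRingType) (p : spec R).

(** The image of [c] in V_p is killed by a power of each element of p; the factor [s] clears
    denominators. *)
Definition locally_nilpotent (V : lmodType R) (c : V) : Prop :=
  forall x, prime_set p x -> exists s k, ~ prime_set p s /\ (s * x ^+ k) *: c = 0.

(** Criterion behind both inclusions: the annihilator condition keeps [c] nonzero in H^n(M)_p, and
    the nilpotency conditions give the torsion needed in degrees up to [n]. *)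
Lemma supp_of_class (M : complex R) (n : int) (c : cohomology M n) :
  ann c `<=` p -> locally_nilpotent c ->
  (forall i, i < n -> forall c' : cohomology M i, locally_nilpotent c') ->
  supp M p.
Proof.
move=> annc nilc nil_lt.
pose S := prime_compl p; pose N := loc_complex S M.
have tors i (v : M i) (s : denom S) dv : locally_nilpotent (@coh_class _ M i v dv) ->
    power_torsion_cocycle p (Defs.frac v s : N i).
  move=> nilv x /nilv[u [k [pu]]]; move/scale_coh_class_eq0 => bv; exists k.
  rewrite fracZ; apply/loc_bounds; exists u; first exact/asboolP.
  by rewrite scalerA.
have tN : torsion_detected N p n.
  split=> [i lt_in|].
    elim/frac_ind=> v s /loc_cocycle[u uS duv].
    (* For a cocycle v/s of M_p, only some multiple uv need be a cocycle of M, so the fraction is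
       rewritten as uv/us. *)
    rewrite -(frac_simpl uS); apply: tors; exact: nil_lt.
  have [z [dz cz]] := coh_class_ex c.
  exists (Defs.frac z (denom1 S)); split.
  - rewrite -[LHS]/(loc_map S (diff M _) _) loc_mapE dz.
    by apply/frac_eq0; exists 1; rewrite ?rpred1 // scaler0.
  - move/loc_bounds => [u /asboolP pu /(scale_coh_class_eq0 _ dz)].
    by rewrite -cz => uc; apply/pu/annc.
  - by apply: tors; rewrite -cz.
move=> xs xsp; exists n => /cohomology_zeroP z0.
have [_ [z [dz nbz _]]] := Kinf_torsion_detected xsp tN.
exact/nbz/z0.
Qed.

Lemma acyclic_notin_supp (M : complex R) : acyclic M -> ~ supp M p.
Proof.
(* The empty sequence suffices, since it yields M_p itself, which is acyclic with M. *)
move=> acM /(_ [::])[//|i]; apply; apply/cohomology_zeroP => t dt.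
apply/(iso_bounds (@unit_piK R _) (@unit_inK R _) (@unit_pi_diff R _)).
have := unit_pi_diff (erefl (i + 1)) t; rewrite dt raddf0 => /esym.
elim/frac_ind: (unit_pi _ i t) => v s /loc_cocycle[u uS duv].
apply/loc_bounds; exists u => //.
by move/cohomology_zeroP: (acM i); apply.
Qed.
End Support.

(** * Minimal primes *)

Section MinimalPrimes.
Variables (R : comPzRingType) (I S : set R).
Hypotheses (I0 : I 0) (ID : forall a b, I a -> I b -> I (a + b)).
Hypothesis IM : forall r a, I a -> I (r * a).
Hypotheses (S1 : S 1) (SM : forall a b, S a -> S b -> S (a * b)).
Hypothesis SI : forall a, S a -> ~ I a.

Let admissible (T : set R) : Prop :=
  [/\ S `<=` T, forall a b, T a -> T b -> T (a * b) & forall a, T a -> ~ I a].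

(* The minimal primes over I are the complements of the multiplicative sets
   maximal among those disjoint from I. *)
Lemma min_prime_avoiding :
  exists q : spec R, min_primes [set q : spec R | I `<=` q] q /\
    forall s, S s -> ~ prime_set q s.
Proof.
(* Zorn's lemma is applied to the sets A with S united to A admissible, so that the empty chain also
   has an admissible bound, namely S. *)
have [T0 [T0adm T0max]] : exists A, (admissible (S `|` A)) /\
    forall B, A `<` B -> ~ admissible (S `|` B).
  apply: (@Zorn_bigcup R [set A | admissible (S `|` A)]) => F Fadm Ftot.
  split; first by move=> a Sa; left.
  - move=> a b [Sa|[A FA Aa]] [Sb|[B FB Bb]].
    + by left; apply: SM.
    + have [_ h _] := Fadm _ FB; have [||h'|h'] := h a b; [by left|by right|by left|].
      by right; exists B.
    + have [_ h _] := Fadm _ FA; have [|||] := h a b; [by right|by left|by left|].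
      by right; exists A.
    + have [AB|BA] := Ftot _ _ FA FB.
        have [_ h _] := Fadm _ FB; have [|||] := h a b;
          [by right; apply: AB|by right|by left|by right; exists B].
      have [_ h _] := Fadm _ FA; have [|||] := h a b;
        [by right|by right; apply: BA|by left|by right; exists A].
  - move=> a [/SI //|[A FA Aa]].
    by have [_ _ h] := Fadm _ FA; apply: h; right.
pose T := S `|` T0.
have [ST TM TI] : admissible T by [].
(* Adjoining the powers of [a] to T gives a strictly larger multiplicative set, which must meet I by
   maximality. *)
have Tmax a : ~ T a -> exists t k, T t /\ I (t * a ^+ k).
  move=> nTa; apply: contrapT => nex.
  pose B := [set b | exists t k, T t /\ b = t * a ^+ k].
  have TB : T `<=` B by move=> t Tt; exists t, 0%N; rewrite expr0 mulr1.
  apply: (T0max B).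
    split; first by move=> t T0t; apply: TB; right.
    move=> BT0; apply: nTa; right; apply: BT0; exists 1, 1%N; split; last by rewrite mul1r.
    exact: ST.
  have -> : S `|` B = B by apply/setUidPr => s Ss; apply/TB/ST.
  split.
  - by move=> s Ss; apply/TB/ST.
  - move=> _ _ [t [k [Tt ->]]] [t' [k' [Tt' ->]]]; exists (t * t'), (k + k')%N.
    by split; [exact: TM | rewrite exprD mulrACA].
  - by move=> _ [t [k [Tt ->]]] Ita; apply: nex; exists t, k.
have T1 : T 1 by exact: ST.
have Isum n (F : 'I_n -> R) : (forall i, I (F i)) -> I (\sum_(i < n) F i).
  by move=> IF; apply: big_ind.
have Qprime : prime_ideal (~` T).
  split.
  - by move=> T00; exact: TI T00 I0.
  - move=> a b /Tmax[t [k [Tt Ita]]] /Tmax[t' [k' [Tt' Itb]]] Tab.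
    have Tabn n : T ((a + b) ^+ n).
      by elim: n => [|n IH]; rewrite ?expr0 // exprS; apply: TM.
    (* Each binomial term contains a^k or b^k', hence is a multiple of t a^k or t' b^k' once t t' is
       in front. So this element of T would lie in I. *)
    apply: (TI (t * t' * (a + b) ^+ (k + k'))); first exact: TM (TM _ _ Tt Tt') (Tabn _).
    rewrite exprDn mulr_sumr; apply: Isum => i; rewrite -mulr_natr mulrA.
    rewrite mulrC; apply: IM.
    have [le_ik'|lt_k'i] := leqP i k'.
      rewrite -addnBA // exprD.
      have -> : t * t' * (a ^+ k * a ^+ (k' - i) * b ^+ i) =
        (t' * a ^+ (k' - i) * b ^+ i) * (t * a ^+ k) by ring.
      exact: IM.
    rewrite -(subnK (ltnW lt_k'i)) exprD.
    set u := a ^+ _; set w := b ^+ (i - k').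
    have -> : t * t' * (u * (w * b ^+ k')) = (t * u * w) * (t' * b ^+ k') by ring.
    exact: IM.
  - move=> r a /Tmax[t [k [Tt Ita]]] Tra.
    have Tran n : T ((r * a) ^+ n).
      by elim: n => [|n IH]; rewrite ?expr0 // exprS; apply: TM.
    apply: (TI (t * (r * a) ^+ k)); first exact: TM.
    by rewrite exprMn mulrCA; apply: IM.
  - by apply.
  - move=> a b nTab; apply: contrapT => /not_orP[/contrapT Ta /contrapT Tb].
    by apply: nTab; exact: TM.
exists (Spec Qprime); split; last by move=> s Ss; apply; exact: ST.
split=> [a Ia Ta|q' Iq' sub]; first exact: TI Ta Ia.
have seteq : prime_set q' = ~` T.
  (* For minimality: t a^k lies in I, hence in [q'], while t lies outside [q']; primality puts [a]
     in [q']. *)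
  apply/seteqP; split=> // a /Tmax[t [k [Tt /Iq' Iq]]].
  have qM := prime_idealM (Defs.primeP q').
  have [/sub //|] := qM _ _ Iq.
  elim: k {Iq} => [|k IH]; first by rewrite expr0 => /(prime_ideal1 (Defs.primeP q')).
  by rewrite exprS => /qM[].
case: q' seteq {sub Iq'} => X Xp /= eX; subst X; congr Spec.
exact: Prop_irrelevance.
Qed.
End MinimalPrimes.

Section WeaklyAssociated.
Variables (R : comPzRingType) (V : lmodType R).

Lemma ann_ideal (v : V) : [/\ ann v 0, forall a b, ann v a -> ann v b -> ann v (a + b)
  & forall r a, ann v a -> ann v (r * a)].
Proof.
split; rewrite /ann /=; first by rewrite scale0r.
  by move=> a b va vb; rewrite scalerDl va vb addr0.
by move=> r a va; rewrite -scalerA va scaler0.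
Qed.

Lemma wass_avoiding (v : V) (S : set R) : S 1 ->
  (forall a b, S a -> S b -> S (a * b)) -> (forall a, S a -> a *: v <> 0) ->
  exists q : spec R, [/\ wass V q, min_primes [set q : spec R | ann v `<=` q] q
    & forall s, S s -> ~ prime_set q s].
Proof.
move=> S1 SM Sv; have [v0 vD vM] := ann_ideal v.
have [q [qmin qS]] := min_prime_avoiding v0 vD vM S1 SM Sv.
by exists q; split=> //; exists v.
Qed.

Lemma wass_nonempty (v : V) : v <> 0 -> exists q : spec R, wass V q.
Proof.
move=> v0; have [|a ->|q [qV _ _]] := @wass_avoiding v [set 1] erefl.
- by move=> a b -> ->; rewrite mulr1.
- by rewrite scale1r.
by exists q.
Qed.

(* If every element s x^k with s outside p acts on v nontrivially, some minimal
   prime over ann v avoids all of them, so it lies strictly inside p. *)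
Lemma locally_nilpotent_or (p : spec R) (v : V) :
  locally_nilpotent p v \/
  exists q : spec R, [/\ wass V q, min_primes [set q : spec R | ann v `<=` q] q,
    q `<=` p & q <> p].
Proof.
apply: contrapT => /not_orP[nil nq]; apply: nil => x px; apply: contrapT => nsk.
pose S := [set a | exists s k, ~ prime_set p s /\ a = s * x ^+ k].
have n1 : ~ prime_set p 1 by exact: prime_ideal1 (Defs.primeP p).
have [|||q [qV qmin qS]] := @wass_avoiding v S.
- by exists 1, 0%N; rewrite mul1r expr0.
- move=> _ _ [s [k [ps ->]]] [s' [k' [ps' ->]]]; exists (s * s'), (k + k')%N.
  by split; [case/(prime_idealM (Defs.primeP p)) | rewrite exprD mulrACA].
- by move=> _ [s [k [ps ->]]] sv; apply: nsk; exists s, k.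
apply: nq; exists q; split=> //.
  move=> a qa; apply: contrapT => pa; apply: (qS a) qa.
  by exists a, 0%N; rewrite expr0 mulr1.
move=> eqp; apply: (qS x); last by rewrite eqp.
by exists 1, 1%N; rewrite mul1r.
Qed.

(** In R_p the maximal ideal is the only prime over the annihilator of [v], so each of its elements
    is nilpotent modulo that annihilator. *)
Lemma wass_locally_nilpotent (p : spec R) (v : V) :
  min_primes [set q : spec R | ann v `<=` q] p -> locally_nilpotent p v.
Proof.
move=> [_ pmin]; have [//|[q [_ [qv _] qp neq]]] := locally_nilpotent_or p v.
by case: neq; exact: pmin.
Qed.
End WeaklyAssociated.

(** * Total cohomology *)

Section TotalCohomology.
Variables (R : comPzRingType) (M : complex R).

Lemma coordZ (a : R) (m : total_cohomology M) i :
  Defs.coord (a *: m) i = a *: Defs.coord m i.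
Proof. by []. Qed.

Lemma wass_total i (q : spec R) :
  wass (cohomology M i) q -> wass (total_cohomology M) q.
Proof.
move=> [c qc]; exists (dsum_in (cohomology M) i c).
suff -> : ann (dsum_in (cohomology M) i c) = ann c by [].
apply/seteqP; split=> a; rewrite /ann /= => ac.
  have := congr1 (fun m : total_cohomology M => Defs.coord m i) ac.
  by rewrite /= coordZ /Defs.coord /= dfwith_in.
by rewrite -(linearZ_LR (dsum_in (cohomology M) i)) ac raddf0.
Qed.

(** Otherwise each of the finitely many nonzero coordinates is killed by an element outside p, and
    the product of these elements kills [m] while staying outside p. *)
Lemma ann_coord_subset (p : spec R) (m : total_cohomology M) :
  ann m `<=` p -> exists i, ann (Defs.coord m i) `<=` p.
Proof.
move=> mp; apply: contrapT => nex.
have kill i : exists s, ~ prime_set p s /\ s *: Defs.coord m i = 0.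
  apply: contrapT => nk; apply: nex; exists i => a am; apply: contrapT => pa.
  by apply: nk; exists a.
have /asboolP/finite_seqP[l lP] := dsum_valP m.
have [s [ps sl]] : exists s, ~ prime_set p s /\
    forall i, i \in l -> s *: Defs.coord m i = 0.
  elim: l {lP} => [|i l [s [ps sl]]].
    by exists 1; split=> //; exact: prime_ideal1 (Defs.primeP p).
  have [t [pt ti]] := kill i; exists (s * t); split.
    by case/(prime_idealM (Defs.primeP p)).
  move=> j; rewrite in_cons => /orP[/eqP->|/sl sj]; first by rewrite -scalerA ti scaler0.
  by rewrite mulrC -scalerA sj scaler0.
apply/ps/mp; apply: dsumP => i; rewrite coordZ.
have [i0|i0] := eqVneq (Defs.coord m i) 0; first by rewrite i0 scaler0.
by apply: sl; have : [set` l] i by rewrite -lP.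
Qed.
End TotalCohomology.

(** * Descending chains of primes and conclusion *)

Lemma dcc_min_primes (R : comPzRingType) (X : set (spec R)) (q : spec R) :
  dcc_primes R -> X q -> exists p, min_primes X p.
Proof.
move=> dcc Xq; apply: contrapT => nmin.
(* Membership of [p] in X is kept as a premise so that [f] is a total function; its iterates from
   [q] form a descending chain that never stabilises. *)
have /choice[f fP] p : exists p', X p -> [/\ X p', p' `<=` p & p' <> p].
  apply: contrapT => np; apply: nmin; exists p; split.
    by apply: contrapT => nX; apply: np; exists p.
  by move=> p' Xp' sub; apply: contrapT => ne; apply: np; exists p'.
have XP n : X (iter n f q) by elim: n => [//|n /fP[]].
have [n|N] := dcc (fun n => iter n f q); first by have [] := fP _ (XP n).
move=> /(_ N.+1 (leqnSn N)) /=.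
by have [] := fP _ (XP N).
Qed.

Lemma acyclic_supp0 (R : comPzRingType) (M : complex R) : acyclic M -> supp M = set0.
Proof. by move=> acM; rewrite -subset0 => p; exact: acyclic_notin_supp. Qed.

Lemma not_zero_ex (R : comPzRingType) (V : lmodType R) :
  ~ is_zero V -> exists v : V, v <> 0.
Proof.
move=> nz; apply: contrapT => h; apply: nz => v.
by apply: contrapT => v0; apply: h; exists v.
Qed.

Lemma wass_sub_supp (R : comPzRingType) (M : complex R) (n : int) :
  (forall i : int, i < n -> is_zero (cohomology M i)) ->
  wass (cohomology M n) `<=` supp M.
Proof.
move=> Mlt p [c cp]; apply: (supp_of_class (c := c)).
- exact: cp.1.
- exact: wass_locally_nilpotent.
(* Classes below degree [n] are zero, so trivial witnesses do. *)
- move=> i lt_in c' x _; exists 1, 0%N; rewrite (Mlt i lt_in c') scaler0.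
  by split=> //; exact: prime_ideal1 (Defs.primeP p).
Qed.

Lemma min_wass_sub_supp (R : comPzRingType) (M : complex R) :
  min_primes (wass (total_cohomology M)) `<=` supp M.
Proof.
move=> p [[m mp] pmin].
have [i ip] := ann_coord_subset mp.1.
apply: (supp_of_class (c := Defs.coord m i)) ip _ _.
  move=> x /(wass_locally_nilpotent mp)[s [k [ps sm]]]; exists s, k; split=> //.
  by rewrite -coordZ sm.
(* A class in any degree that is not locally nilpotent would give a weakly associated prime strictly
   inside p, against minimality. *)
move=> j _ c; have [//|[q [qH _ qp neq]]] := locally_nilpotent_or p c.
by case: neq; apply: pmin => //; exact: wass_total qH.
Qed.

Theorem theorem5p5 (R : comPzRingType) :
  [/\ (forall (M : complex R) (n : int),
         (forall i : int, i < n -> is_zero (cohomology M i)) ->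
         wass (cohomology M n) `<=` supp M),
      (forall M : complex R,
         (exists n : int, forall i : int, i < n -> is_zero (cohomology M i)) ->
         (acyclic M <-> supp M = set0)),
      (forall M : complex R, min_primes (wass (total_cohomology M)) `<=` supp M)
    & (dcc_primes R -> supportive R)].
Proof.
split; [exact: wass_sub_supp| |exact: min_wass_sub_supp|].
  move=> M [n Mlt]; split=> [|supp0]; first exact: acyclic_supp0.
  (* Vanishing climbs one degree at a time: the first nonzero cohomology module would have a weakly
     associated prime, which would lie in the support. *)
  have step k : (forall i : int, i < n + k%:Z -> is_zero (cohomology M i)) ->
      is_zero (cohomology M (n + k%:Z)).
    move=> Mk; apply: contrapT => /not_zero_ex[c /wass_nonempty[q qc]].
    by have := wass_sub_supp Mk qc; rewrite supp0.
  have below k (i : int) : i < n + k%:Z -> is_zero (cohomology M i).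
    elim: k i => [|k IH] i; first by rewrite addr0; exact: Mlt.
    rewrite -addn1 PoszD addrA ltzD1 le_eqVlt => /orP[/eqP->|]; last exact: IH.
    exact: step.
  (* The successor makes the bound [n + k] strictly larger than [i]. *)
  move=> i; apply: (below `|i - n|%N.+1).
  rewrite -ltrBlDl -addn1 PoszD ltzD1 abszE; exact: ler_norm.
move=> dcc M; split=> [supp0 i|]; last exact: acyclic_supp0.
apply: contrapT => /not_zero_ex[c /wass_nonempty[q /wass_total qM]].
have [p pmin] := dcc_min_primes dcc qM.
by have := min_wass_sub_supp pmin; rewrite supp0.
Qed.
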